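(* Let $p\ge 1$, let $g:\mathbb{R}^p\to\mathbb{R}^p$ and let $\mu$ be a probability measure on $\mathbb{R}^p$. Consider the functional autoregressive process $X_{n+1}=g(X_n)+Z_{n+1}$ and let $P$ be its Markov kernel, $P(x,A)=\int\mathbf{1}_A(g(x)+z)\,\mu(dz)$. Assume: (AR1) $\{Z_n,n\ge1\}$ is an i.i.d. zero-mean $\mathbb{R}^p$-valued sequence, independent of $X_0$, with common distribution $\mu$, and $\int\exp(\beta_0\|z\|^{\kappa_0})\,\mu(dz)<+\infty$ for some $\beta_0>0$ and $\kappa_0\in(0,1]$; (AR2) for all $M>0$, $g$ is $C_M$-Lipschitz on the ball $B(0,M)$ with respect to $\|\cdot\|$, where $C_M\in(0,1)$; furthermore there exist positive constants $r,M_0$ and $\rho\in[0,2)$ such that $\|g(x)\|\le\|x\|(1-r\|x\|^{-\rho})$ if $\|x\|\ge M_0$. Then $P$ admits a unique invariant distribution $\pi$. Moreover: (i) If $\rho>\kappa_0$, there exist $\beta\in(0,\beta_0)$ and constants $C_1$ and $C_2>0$ such that, with $V(x)=\exp\left(\beta\|x\|^{\kappa_0\wedge(2-\rho)}\right)$ and $\varsigma=(\kappa_0\wedge(2-\rho))/\rho$, for all $x\in\mathbb{R}^p$ and all integers $n\ge1$, $$W_{d_1}(P^n(x,\cdot),\pi)\le C_1V(x)\exp(-C_2n^{\varsigma}).$$ (ii) If $\rho\le\kappa_0$, there exist $\beta\in(0,\beta_0)$, $\tilde\zeta\in(0,1)$ and a constant $C$ such that, with $V(x)=\exp(\beta\|x\|^{\kappa_0})$,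 for all $x\in\mathbb{R}^p$ and all integers $n\ge1$, $$W_{d_1}(P^n(x,\cdot),\pi)\le C\,V(x)\,\tilde\zeta^{\,n}.$$
   Context: $\|\cdot\|$ is the Euclidean norm on $\mathbb{R}^p$, $B(x,M)$ is the ball of radius $M$ centered at $x$, and $a\wedge b=\min(a,b)$. The distance $d_1$ on $\mathbb{R}^p$ is $d_1(x,y)=1\wedge\|x-y\|$. For probability measures $\mu_1,\mu_2$ on $\mathbb{R}^p$, $W_{d_1}(\mu_1,\mu_2)=\inf_\gamma\int d_1(x,y)\,d\gamma(x,y)$ over all couplings $\gamma$ of $\mu_1$ and $\mu_2$. $P^n$ is the $n$-th iterate of $P$. *)

(* Defs.v *)
From HB Require Import structures.
From mathcomp Require Import all_boot all_order all_algebra.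
From mathcomp Require Import all_classical all_reals all_analysis.

Set Implicit Arguments.
Unset Strict Implicit.
Unset Printing Implicit Defensive.

Import Order.TTheory GRing.Theory Num.Theory.
Import numFieldTopology.Exports numFieldNormedType.Exports.

Local Open Scope classical_set_scope.
Local Open Scope ring_scope.

(* R^p is 'rV[R]_p with its Borel sigma-algebra.  Products of measurable types
   carry the product sigma-algebra. *)
HB.instance Definition _ (R : realType) (p : nat) :=
  @isMeasurable.Build (sigma_display (@open 'rV[R]_p)) 'rV[R]_p
    <<s (@open 'rV[R]_p) >> (@sigma_algebra0 _ setT (@open 'rV[R]_p))
    (@sigma_algebraC _ (@open 'rV[R]_p))
    (@sigma_algebra_bigcup _ setT (@open 'rV[R]_p)).

(* The library norm on 'rV[R]_p is the sup norm. *)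
Definition enorm (R : realType) (p : nat) (x : 'rV[R]_p) : R :=
  Num.sqrt (\sum_(i < p) x 0 i ^+ 2).

Definition d1 (R : realType) (p : nat) (x y : 'rV[R]_p) : R :=
  Num.min 1 (enorm (x - y)).

Section kernels.
Context d (T : measurableType d) (R : realType).
Local Open Scope ereal_scope.

(* Laws and kernels are set functions here, so that the definitions below need
   no proof of measurability of the kernel; they are only meaningful for genuine
   Markov kernels. *)
Fixpoint kernel_iter (P : T -> set T -> \bar R) (n : nat)
    (x : T) (A : set T) : \bar R :=
  if n is m.+1 then \int[P x]_y kernel_iter P m y A else (\1_A x)%:E.

Definition invariant_dist (P : T -> set T -> \bar R) (pi : probability T R) :=
  forall A, measurable A -> pi A = \int[pi]_x P x A.

Definition coupling (m1 m2 : set T -> \bar R)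
    (gamma : probability (T * T)%type R) :=
  forall A, measurable A ->
    gamma (fst @^-1` A) = m1 A /\ gamma (snd @^-1` A) = m2 A.

Definition wasserstein (c : T -> T -> R) (m1 m2 : set T -> \bar R) : \bar R :=
  ereal_inf [set \int[gamma]_xy (c xy.1 xy.2)%:E | gamma in coupling m1 m2].

End kernels.

Definition ar_kernel (R : realType) (p : nat) (g : 'rV[R]_p -> 'rV[R]_p)
    (mu : probability 'rV[R]_p R) (x : 'rV[R]_p) (A : set 'rV[R]_p) : \bar R :=
  (\int[mu]_z (\1_A (g x + z))%:E)%E.

Section independence.
Context d (Omega : measurableType d) (R : realType) (Pr : probability Omega R).
Context d' (T : measurableType d').
Local Open Scope ereal_scope.

Definition mutually_independent (Y : nat -> Omega -> T) :=
  forall (s : seq nat) (B : nat -> set T), uniq s ->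
    (forall n, measurable (B n)) ->
    Pr (\bigcap_(n in [set` s]) (Y n @^-1` B n)) =
    \prod_(n <- s) Pr (Y n @^-1` B n).

(* [E] ranges over the sigma-algebra generated by the whole sequence [Y]. *)
Definition independent_of_seq (X0 : Omega -> T) (Y : nat -> Omega -> T) :=
  forall A E, measurable A ->
    <<s \bigcup_n preimage_set_system setT (Y n) measurable >> E ->
    Pr (X0 @^-1` A `&` E) = Pr (X0 @^-1` A) * Pr E.

End independence.

(* [Z n] is the innovation usually written Z_{n+1}. *)
Definition ar_process (R : realType) (p : nat) d (Omega : measurableType d)
    (Pr : probability Omega R) (g : 'rV[R]_p -> 'rV[R]_p)
    (X : nat -> {RV Pr >-> 'rV[R]_p}) (Z : nat -> {RV Pr >-> 'rV[R]_p}) :=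
  forall n w, X n.+1 w = g (X n w) + Z n w.

Definition AR1 (R : realType) (p : nat) d (Omega : measurableType d)
    (Pr : probability Omega R) (mu : probability 'rV[R]_p R)
    (X0 : {RV Pr >-> 'rV[R]_p}) (Z : nat -> {RV Pr >-> 'rV[R]_p})
    (beta0 kappa0 : R) :=
  [/\ mutually_independent Pr Z,
      independent_of_seq Pr X0 Z,
      forall n A, measurable A -> distribution Pr (Z n) A = mu A,
      forall n (i : 'I_p), ('E_Pr[fun w => Z n w 0%R i] = 0)%E &
      [/\ 0 < beta0, 0 < kappa0 <= 1 &
          (\int[mu]_z (expR (beta0 * enorm z `^ kappa0))%:E < +oo)%E]].

Definition lipschitz_on_ball (R : realType) (p : nat)
    (g : 'rV[R]_p -> 'rV[R]_p) (M C : R) :=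
  forall x y, enorm x <= M -> enorm y <= M ->
    enorm (g x - g y) <= C * enorm (x - y).

Definition AR2 (R : realType) (p : nat) (g : 'rV[R]_p -> 'rV[R]_p) (rho : R) :=
  (forall M, 0 < M -> exists C, 0 < C < 1 /\ lipschitz_on_ball g M C) /\
  0 <= rho < 2 /\
  exists r M0, [/\ 0 < r, 0 < M0 &
    forall x, M0 <= enorm x ->
      enorm (g x) <= enorm x * (1 - r * enorm x `^ (- rho))].

(* Main.v *)
Require Import Defs.
From HB Require Import structures.
From mathcomp Require Import all_boot all_order all_algebra.
From mathcomp Require Import all_classical all_reals all_analysis.
From mathcomp Require Import measurable_realfun ring lra.

(** Run two copies of the chain with the same innovations. After one step their
    difference is g x - g y: the noise has disappeared. Since g contracts
    strictly on every ball, the distance never grows, and it shrinks by a fixed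
    factor whenever both copies lie in a given ball. It remains to see that
    both copies return to a ball often enough.

    The function V x = exp (b |x| ^ s), with s = min (kappa0, 2 - rho), has the
    drift P V <= (1 - c |x| ^ (s - rho)) V far from the origin
    ([drift_pointwise], [kernel_drift]): |g x + z| ^ 2 expands into an inner
    product with the centred innovation, which integrates to zero, and terms of
    second order. Hence |x - y| (V x + V y + K) decreases in one step by the
    factor 1 - c1 q ^ (s - rho), up to an error of relative size
    exp (- b q ^ s) due to states beyond an arbitrary radius q; the error is
    measured with the cube of V, which is a Lyapunov function of the same kind
    ([pair_step], [pair_iter]). After n steps the radius q = n ^ (1 / rho)
    makes both contributions of order exp (- c n ^ (s / rho))
    ([sync_contraction]).

    The invariant law comes from composing the random maps x |-> g x + Z_k
    backward, the latest one being applied first. The n-th backward iterate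
    from x has the law P^n (x, .) ([integral_backward]), and the n-th and
    (n + 1)-st iterates from 0 are the positions after n steps of two coupled
    chains, so their expected distance is summable in n. The iterates therefore
    converge almost surely ([L1_coord_limit]). The law of the limit is the
    invariant law, and the pair formed by the n-th iterate and the limit is a
    coupling that gives the rate ([wasserstein_stationary]); d1 is simply
    bounded by the distance.

    The same estimate gives P^n h -> pi h at every point for bounded Lipschitz
    h ([transition_iter_cvg]). As such functions determine a probability
    ([lipschitz_determining]), pi is invariant and no other law is.

    If rho <= kappa0, the drift condition also holds with kappa0 in place of
    rho, and then s = kappa0 and s / kappa0 = 1: the geometric regime is a case
    of the stretched exponential one ([autoregressive_ergodicity]). *)

Import Order.TTheory GRing.Theory Num.Theory.
Import numFieldTopology.Exports numFieldNormedType.Exports.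

Local Open Scope classical_set_scope.
Local Open Scope ring_scope.

Set Implicit Arguments.
Unset Strict Implicit.
Unset Printing Implicit Defensive.

(** * Euclidean norm and Borel sets of R^p *)

Section euclidean_norm.
Context {R : realType} {p : nat}.
Implicit Types x y z : 'rV[R]_p.

Definition edot x y : R := \sum_(i < p) x 0 i * y 0 i.

Lemma enorm_ge0 x : 0 <= enorm x.
Proof. exact: sqrtr_ge0. Qed.

Lemma enorm_sqr x : enorm x ^+ 2 = \sum_(i < p) x 0 i ^+ 2.
Proof. by rewrite sqr_sqrtr// sumr_ge0// => i _; exact: sqr_ge0. Qed.

Lemma enorm0 : enorm (0 : 'rV[R]_p) = 0.
Proof.
by rewrite /enorm big1 ?sqrtr0// => i _; rewrite mxE expr0n.
Qed.

Lemma enormN x : enorm (- x) = enorm x.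
Proof.
by rewrite /enorm; congr Num.sqrt; apply: eq_bigr => i _; rewrite mxE sqrrN.
Qed.

Lemma enormC x y : enorm (x - y) = enorm (y - x).
Proof. by rewrite -enormN opprB. Qed.

Lemma enormD_sqr x y :
  enorm (x + y) ^+ 2 = enorm x ^+ 2 + 2 * edot x y + enorm y ^+ 2.
Proof.
rewrite !enorm_sqr /edot mulr_sumr -!big_split/=; apply: eq_bigr => i _.
by rewrite mxE; ring.
Qed.

Lemma Cauchy_Schwarz_edot x y : `|edot x y| <= enorm x * enorm y.
Proof.
suff : edot x y ^+ 2 <= (enorm x * enorm y) ^+ 2.
  by move=> h; rewrite -ler_sqr ?nnegrE ?mulr_ge0 ?enorm_ge0// real_normK// num_real.
(* By Lagrange's identity this double sum is twice the defect of the inequality. *)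
have : 0 <= \sum_(i < p) \sum_(j < p) (x 0 i * y 0 j - x 0 j * y 0 i) ^+ 2.
  by apply: sumr_ge0 => i _; apply: sumr_ge0 => j _; exact: sqr_ge0.
have -> : \sum_(i < p) \sum_(j < p) (x 0 i * y 0 j - x 0 j * y 0 i) ^+ 2 =
    2 * ((enorm x * enorm y) ^+ 2 - edot x y ^+ 2).
  transitivity (\sum_(i < p) \sum_(j < p) (x 0 i ^+ 2 * y 0 j ^+ 2
      + (x 0 j ^+ 2 * y 0 i ^+ 2 - 2 * ((x 0 i * y 0 i) * (x 0 j * y 0 j))))).
    by apply: eq_bigr => i _; apply: eq_bigr => j _; ring.
  under eq_bigr do rewrite !big_split/=.
  rewrite !big_split/= exprMn !enorm_sqr.
  have H (a b : 'I_p -> R) : \sum_i \sum_j a i * b j = (\sum_i a i) * \sum_j b j.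
    by rewrite mulr_suml; apply: eq_bigr => i _; rewrite mulr_sumr.
  have H' (a b : 'I_p -> R) : \sum_i \sum_j a j * b i = (\sum_i a i) * \sum_j b j.
    by rewrite exchange_big H.
  rewrite H H'.
  under [X in _ + (_ + X) = _]eq_bigr do rewrite sumrN -mulr_sumr.
  by rewrite sumrN -mulr_sumr H /edot; ring.
by rewrite pmulr_rge0// subr_ge0.
Qed.

Lemma enorm_triangle x y : enorm (x + y) <= enorm x + enorm y.
Proof.
rewrite -ler_sqr ?nnegrE ?addr_ge0 ?enorm_ge0// enormD_sqr.
have := le_trans (ler_norm _) (Cauchy_Schwarz_edot x y).
by rewrite sqrrD; move: (_ * _) => a h; lra.
Qed.

Lemma enorm_triangleB x y z : enorm (x - z) <= enorm (x - y) + enorm (y - z).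
Proof. by rewrite (le_trans _ (enorm_triangle _ _))// addrA subrK. Qed.

Lemma enorm_lerB x y : enorm x - enorm y <= enorm (x - y).
Proof. by rewrite lerBlDr (le_trans _ (enorm_triangle _ _))// subrK. Qed.

Lemma coord_le_enorm x i : `|x 0 i| <= enorm x.
Proof.
rewrite -ler_sqr ?nnegrE ?enorm_ge0// real_normK ?num_real// enorm_sqr.
by rewrite (bigD1 i)//= lerDl sumr_ge0// => j _; exact: sqr_ge0.
Qed.

Lemma d1_le_enorm x y : d1 x y <= enorm (x - y).
Proof. by rewrite /d1 ge_min lexx orbT. Qed.

Lemma ball_rVP x (e : R) y : 0 < e ->
  ball x e y <-> forall i, `|x 0 i - y 0 i| < e.
Proof.
move=> e0; split=> [[_ xy] i|xy]; first exact: (xy 0 i).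
by split=> // i j; rewrite (ord1 i); exact: xy.
Qed.

Lemma enorm_ball x (e : R) y : 0 < e -> enorm (x - y) < e -> ball x e y.
Proof.
move=> e0 xy; apply/ball_rVP => // i; apply: le_lt_trans xy.
by have := coord_le_enorm (x - y) i; rewrite !mxE.
Qed.

End euclidean_norm.

Section measurability.
Context {R : realType} {p : nat}.

Lemma measurable_coord (i : 'I_p) :
  measurable_fun setT (fun x : 'rV[R]_p => x 0 i).
Proof.
apply: (measurability _ (RGenOpens.measurableE R)).
move=> _ [_ [a [b ->] <-]]; rewrite setTI.
suff : open ((fun x : 'rV[R]_p => x 0 i) @^-1` `]a, b[).
  by move=> ?; exact: sub_sigma_algebra.
rewrite openE => x /= abx.
have : nbhs (x 0 i) `]a, b[%classic.
  by apply: open_nbhs_nbhs; split => //; exact: interval_open.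
move=> /nbhs_ballP[e /= e0 xab]; apply/nbhs_ballP; exists e => //= y xy.
by apply: xab; case: xy => _ /(_ 0 i).
Qed.

(** An open set is the union of the rational boxes that it contains, so it is
    obtained from countably many conditions on the coordinates. This is what
    makes sums of measurable vectors measurable although the sigma-algebra of a
    product space is not defined from open sets. *)
Lemma measurable_fun_rV d (T : measurableType d) (f : T -> 'rV[R]_p) :
  (forall i, measurable_fun setT (fun w => f w 0 i)) -> measurable_fun setT f.
Proof.
move=> mf; apply: (@measurability _ _ _ _ setT f (@open 'rV[R]_p)) => //.
move=> _ [U oU <-]; rewrite setTI.
pose box (q : 'rV[rat]_p) (k : nat) :=
  [set x : 'rV[R]_p | forall i, `|x 0 i - ratr (q 0 i)| < k.+1%:R^-1].
have -> : U = \bigcup_(qk in [set qk : 'rV[rat]_p * nat | box qk.1 qk.2 `<=` U])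
    box qk.1 qk.2.
  apply/seteqP; split => [x Ux|x [qk /= + +]]; last exact.
  have /nbhs_ballP[e /= e0 xeU] : nbhs x U by exact: open_nbhs_nbhs.
  pose k := Num.truncn (2 / e).
  have ke : k.+1%:R^-1 < e / 2.
    rewrite -[e / 2]invrK ltf_pV2 ?posrE ?invr_gt0 ?divr_gt0// invf_div.
    exact: truncnS_gt.
  have /choice[q xq] i : exists q : rat, `|x 0 i - ratr q| < k.+1%:R^-1.
    have : x 0 i - k.+1%:R^-1 < x 0 i + k.+1%:R^-1.
      by rewrite ltrD2l gtrN// invr_gt0.
    move=> /rat_in_itvoo[q]; rewrite in_itv/= => xq; exists q.
    by rewrite distrC ltr_distl.
  exists (\row_i q i, k) => /=; last by move=> i; rewrite mxE.
  move=> y yq; apply: xeU; apply/ball_rVP => // i.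
  have := yq i; rewrite mxE => {}yq; rewrite [e]splitr.
  rewrite (le_lt_trans (ler_distD (ratr (q i)) _ _))// ltrD//.
    exact: lt_trans (xq i) ke.
  by rewrite distrC; exact: lt_trans yq ke.
rewrite preimage_bigcup bigcup_mkcond.
apply: countable_bigcupT_measurable => // -[q k].
case: ifPn => // _ /=.
rewrite [X in measurable X](_ : _ = \bigcap_(i in [set: 'I_p])
    ((fun w => f w 0 i) @^-1` ball (ratr (q 0 i) : R) k.+1%:R^-1)); last first.
  apply/seteqP; split => w /= h i; first by move=> _ /=; rewrite /ball/= distrC.
  by rewrite distrC; exact: h.
apply: fin_bigcap_measurable => // i _.
rewrite -[X in measurable X]setTI; apply: mf => //.
exact: measurable_ball.
Qed.

Lemma measurable_rVD d (T : measurableType d) (f h : T -> 'rV[R]_p) :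
  measurable_fun setT f -> measurable_fun setT h ->
  measurable_fun setT (fun w => f w + h w).
Proof.
move=> mf mh; apply: measurable_fun_rV => i.
under eq_fun do rewrite mxE.
by apply: measurable_funD; apply: (measurableT_comp (measurable_coord i)).
Qed.

Lemma measurable_rVB d (T : measurableType d) (f h : T -> 'rV[R]_p) :
  measurable_fun setT f -> measurable_fun setT h ->
  measurable_fun setT (fun w => f w - h w).
Proof.
move=> mf mh; apply: measurable_fun_rV => i.
under eq_fun do rewrite !mxE.
by apply: measurable_funB; apply: (measurableT_comp (measurable_coord i)).
Qed.

Lemma measurable_enorm : measurable_fun setT (@enorm R p).
Proof.
rewrite [X in measurable_fun _ X](_ : _ =
    fun x : 'rV[R]_p => (\sum_(i < p) x 0 i ^+ 2) `^ 2^-1).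
  apply: (measurableT_comp (measurable_powR _)); apply: measurable_sum => i.
  by apply: measurable_funX; exact: measurable_coord.
by apply/funext => x; rewrite powR12_sqrt// sumr_ge0// => i _; exact: sqr_ge0.
Qed.

End measurability.

(** * Backward iteration of independent random maps *)

Section image_law.
Local Open Scope ereal_scope.
Context d (Omega : measurableType d) {R : realType} (Pr : probability Omega R).
Context d' (T : measurableType d').
Variables (f : Omega -> T) (mf : measurable_fun setT f).

Let f_mfun : {mfun Omega >-> T} :=
  HB.pack f (isMeasurableFun.Build _ _ _ _ f mf).

(** The image probability, with the measurability proof as a visible argument:
    it stays usable when the same function is considered for several
    sigma-algebras. *)
Definition law : probability T R := distribution Pr f_mfun.

Lemma lawE A : law A = Pr (f @^-1` A).
Proof. by []. Qed.

Lemma ge0_integral_law (h : T -> \bar R) : measurable_fun setT h ->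
  (forall x, 0 <= h x) -> \int[law]_x h x = \int[Pr]_w h (f w).
Proof. by move=> mh h0; rewrite ge0_integral_distribution. Qed.

End image_law.
Arguments law {d Omega R} Pr {d' T f} mf.
Arguments ge0_integral_law {d Omega R} Pr {d' T f} mf [h].

Section backward_iteration.
Context dE (E : measurableType dE) dT (T : measurableType dT).
Variable F : E * T -> E.

(** Composing the random maps backward, the latest innovation being applied
    first: each [backward Z n] has the law of the n-th state of the chain, but
    unlike the chain itself the sequence converges pathwise. *)
Fixpoint backward {Omega : Type} (Z : nat -> Omega -> T) (n : nat)
    (w : Omega) (x : E) : E :=
  if n is m.+1 then backward Z m w (F (x, Z m w)) else x.

Hypothesis mF : measurable_fun setT F.

Lemma measurable_backward2 d (Omega : measurableType d)
    (Z : nat -> Omega -> T) n :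
  (forall k, (k < n)%N -> measurable_fun setT (Z k)) ->
  measurable_fun setT (fun wx : Omega * E => backward Z n wx.1 wx.2).
Proof.
elim: n => [|n IH] mZ /=; first exact: measurable_snd.
have mIH : measurable_fun setT (fun wx : Omega * E => backward Z n wx.1 wx.2).
  by apply: IH => k kn; apply: mZ; rewrite ltnS ltnW.
apply: (measurableT_comp mIH (g := fun wx => (wx.1, F (wx.2, Z n wx.1)))).
apply: measurable_fun_pair; first exact: measurable_fst.
apply: (measurableT_comp mF); apply: measurable_fun_pair.
  exact: measurable_snd.
by apply: (measurableT_comp (mZ n _)) => //; exact: measurable_fst.
Qed.

Lemma measurable_backward d (Omega : measurableType d)
    (Z : nat -> Omega -> T) n x :
  (forall k, measurable_fun setT (Z k)) ->
  measurable_fun setT (fun w => backward Z n w x).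
Proof.
move=> mZ.
apply: (measurableT_comp (@measurable_backward2 _ _ Z n _) (g := fun w => (w, x))) => //.
Qed.

End backward_iteration.
Arguments backward {dE E dT T} F {Omega} Z n w x.
Arguments measurable_backward2 {dE E dT T F} mF {d Omega Z} n _.
Arguments measurable_backward {dE E dT T F} mF {d Omega Z} n x _.

Section independence_of_the_past.
Local Open Scope ereal_scope.
Context d (Omega : measurableType d) {R : realType} (Pr : probability Omega R).
Context dT (T : measurableType dT) (Z : nat -> Omega -> T).
Variable mu : probability T R.
Hypothesis mZ : forall k, measurable_fun setT (Z k).
Hypothesis indZ : mutually_independent Pr Z.
Hypothesis lawZ : forall n A, measurable A -> Pr (Z n @^-1` A) = mu A.

Let mpreZ k A : measurable A -> measurable (Z k @^-1` A).
Proof. by move=> mA; rewrite -[X in measurable X]setTI; exact: mZ. Qed.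

(** A pi-system that generates the sigma-algebra of the first n innovations. *)
Definition cylinders (n : nat) : set (set Omega) :=
  [set C | exists B : nat -> set T, (forall k, measurable (B k)) /\
     C = \bigcap_(k in [set` iota 0 n]) (Z k @^-1` B k)].

Notation past n := (g_sigma_algebraType (cylinders n)).

Lemma cylinders_measurable n : cylinders n `<=` measurable.
Proof.
move=> _ [B [mB ->]]; apply: fin_bigcap_measurable => // k _; exact: mpreZ.
Qed.

Lemma cylindersT n : cylinders n setT.
Proof.
exists (fun=> setT); split=> //.
by apply/esym; rewrite -subTset => w _ k _.
Qed.

Lemma cylinders_setI n : setI_closed (cylinders n).
Proof.
move=> _ _ [B [mB ->]] [C [mC ->]]; exists (fun k => B k `&` C k).
split=> [k|]; first exact: measurableI.
apply/seteqP; split=> w; first by move=> [wB wC] k kn; split; [exact: wB|exact: wC].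
by move=> wBC; split=> k kn; have [] := wBC k kn.
Qed.

Lemma past_sub n (A : set Omega) : @measurable _ (past n) A -> measurable A.
Proof.
apply: smallest_sub => //; last exact: cylinders_measurable.
exact: sigma_algebra_measurable.
Qed.

Lemma measurable_past n k : (k < n)%N ->
  measurable_fun [set: past n] (Z k : past n -> T).
Proof.
move=> kn _ A mA; rewrite setTI; apply: sub_sigma_algebra.
exists (fun j => if j == k then A else setT); split.
  by move=> j; case: ifP.
apply/seteqP; split => w.
  by move=> wA j _; case: ifPn => // /eqP ->.
by move=> /(_ k); rewrite /= mem_iota add0n kn eqxx; exact.
Qed.

(** On cylinders this is the product rule; both sides are finite measures in A,
    hence they agree on the generated sigma-algebra. *)
Lemma past_independent n A B : @measurable _ (past n) A -> measurable B ->
  Pr (A `&` Z n @^-1` B) = Pr A * mu B.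
Proof.
move=> mA mB.
have mZB : measurable (Z n @^-1` B) by exact: mpreZ.
have muB : mu B = (fine (mu B))%:E by rewrite fineK// fin_num_measure.
pose c : {nonneg R} := NngNum (fine_ge0 (measure_ge0 mu B)).
have := @g_sigma_algebra_measure_unique _ R Omega (cylinders n)
  (@cylinders_measurable n) (fun=> setT) (fun=> cylindersT n) _
  (mrestr Pr mZB) (mscale c Pr) (@cylinders_setI n) _ _ A mA.
rewrite /mrestr /mscale /= muB [X in _ -> _ = X]muleC; apply.
- by rewrite bigcup_const//; exists 0%N.
- move=> _ [C [mC ->]].
  have := @indZ (iota 0 n.+1)
    (fun k => if (k < n)%N then C k else B) (iota_uniq _ _).
  have mCB k : measurable (if (k < n)%N then C k else B) by case: ifP.
  move=> /(_ mCB); rewrite -addn1 iotaD cats1 add0n /=.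
  rewrite -cats1 big_cat big_seq1 ltnn /=.
  have -> : \prod_(k <- iota 0 n) Pr (Z k @^-1` (if (k < n)%N then C k else B))
      = \prod_(k <- iota 0 n) Pr (Z k @^-1` C k).
    rewrite big_seq [RHS]big_seq; apply: eq_bigr => k.
    by rewrite mem_iota add0n => /= ->.
  rewrite -indZ ?iota_uniq// lawZ// muB => H.
  rewrite /mscale/= muleC -[RHS]H; congr (Pr _).
  apply/seteqP; split=> w.
    move=> [wC wB] k /=; rewrite mem_cat mem_iota add0n/= mem_seq1.
    case: ifPn => [kn _|_ /= /eqP ->//].
    by apply: wC; rewrite /= mem_iota add0n.
  move=> wH; split=> [k /=|].
    rewrite mem_iota add0n/= => kn; have := wH k; rewrite /= mem_cat mem_iota.
    by rewrite add0n/= kn; exact.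
  have := wH n; rewrite /= mem_cat mem_seq1 eqxx orbT ltnn; exact.
- move=> _; rewrite /= /mrestr (le_lt_trans (probability_le1 _ _))// ?ltry//.
  by rewrite setTI.
Qed.

Let mid n : measurable_fun [set: Omega] (id : Omega -> past n).
Proof. by move=> _ A mA; rewrite setTI; exact: past_sub mA. Qed.

Let mpair n : measurable_fun [set: Omega] (fun w : Omega => (w : past n, Z n w)).
Proof. by apply: measurable_fun_pair; [exact: mid|exact: mZ]. Qed.

(** Fubini for a function of the past and of one fresh innovation: by
    independence their joint law is a product measure. *)
Lemma integral_past_fresh n (h : past n * T -> \bar R) :
  measurable_fun setT h -> (forall x, 0 <= h x) ->
  \int[Pr]_w h (w, Z n w) = \int[mu]_z \int[Pr]_w h (w, z).
Proof.
move=> mh h0.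
rewrite -(ge0_integral_law Pr (@mpair n))//.
transitivity (\int[law Pr (@mid n) \x mu]_x h x).
  apply: eq_measure_integral => A mA _; apply/esym.
  apply: product_measure_unique => // {A mA}B C mB mC.
  exact: past_independent.
rewrite (fubini_tonelli2 (m1 := law Pr (@mid n)) (m2 := mu))//.
apply: eq_integral => z _; rewrite /fubini_G (ge0_integral_law Pr (@mid n))//.
by apply: (measurableT_comp mh); exact: measurable_fun_pair.
Qed.

End independence_of_the_past.
Arguments measurable_past {d Omega dT T} Z {n k} _.
Arguments integral_past_fresh {d Omega R Pr dT T Z mu} _ _ _ {n h} _ _.

Section transition_operator.
Local Open Scope ereal_scope.
Context dE (E : measurableType dE) dT (T : measurableType dT) {R : realType}.
Variables (F : E * T -> E) (mu : probability T R).
Hypothesis mF : measurable_fun setT F.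

Definition transition (f : E -> \bar R) (x : E) : \bar R :=
  \int[mu]_z f (F (x, z)).

Lemma transition_ge0 f : (forall x, 0 <= f x) -> forall x, 0 <= transition f x.
Proof. by move=> f0 x; exact: integral_ge0. Qed.

Lemma measurable_transition f : measurable_fun setT f -> (forall x, 0 <= f x) ->
  measurable_fun setT (transition f).
Proof.
move=> mf f0.
apply: (measurable_fun_fubini_tonelli_F (m2 := mu) (fun xz => f (F xz))) => //.
exact: measurableT_comp.
Qed.

Lemma iter_transition_ge0 n f : (forall x, 0 <= f x) ->
  forall x, 0 <= iter n transition f x.
Proof. by move=> f0; elim: n => [//|n IH] x; exact: transition_ge0. Qed.

Lemma measurable_iter_transition n f :
  measurable_fun setT f -> (forall x, 0 <= f x) ->
  measurable_fun setT (iter n transition f).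
Proof.
move=> mf f0; elim: n => [//|n IH] /=; apply: measurable_transition => //.
exact: iter_transition_ge0.
Qed.

Let mF1 x : measurable_fun setT (fun z => F (x, z)).
Proof. by apply: (measurableT_comp mF); exact: measurable_fun_pair. Qed.

Lemma le_transition f h : measurable_fun setT f -> measurable_fun setT h ->
  (forall x, 0 <= f x) -> (forall x, f x <= h x) ->
  forall x, transition f x <= transition h x.
Proof.
move=> mf mh f0 fh x; apply: ge0_le_integral => //.
  exact: (measurableT_comp mf).
exact: (measurableT_comp mh).
Qed.

Lemma le_iter_transition n f h :
  measurable_fun setT f -> measurable_fun setT h ->
  (forall x, 0 <= f x) -> (forall x, f x <= h x) ->
  forall x, iter n transition f x <= iter n transition h x.
Proof.
move=> mf mh f0 fh; have h0 x : 0 <= h x by exact: le_trans (f0 x) (fh x).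
elim: n => [//|n IH] x /=; apply: le_transition => //.
- exact: measurable_iter_transition.
- exact: measurable_iter_transition.
- exact: iter_transition_ge0.
Qed.

Lemma transition_affine f h a b c :
  measurable_fun setT f -> measurable_fun setT h ->
  (forall x, 0 <= f x) -> (forall x, 0 <= h x) ->
  (0 <= a)%R -> (0 <= b)%R -> (0 <= c)%R ->
  forall x, transition (fun y => a%:E * f y + b%:E * h y + c%:E) x =
  a%:E * transition f x + b%:E * transition h x + c%:E.
Proof.
move=> mf mh f0 h0 a0 b0 c0 x; rewrite /transition.
have mf' := measurableT_comp mf (mF1 x).
have mh' := measurableT_comp mh (mF1 x).
rewrite ge0_integralD//=.
- rewrite integral_cst//= probability_setT mule1; congr (_ + _).
  rewrite ge0_integralD//=.
  + by rewrite !ge0_integralZl_EFin.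
  + by move=> z _; rewrite mule_ge0.
  + exact: measurable_funeM.
  + by move=> z _; rewrite mule_ge0.
  + exact: measurable_funeM.
- by move=> z _; rewrite adde_ge0// mule_ge0.
- by apply: emeasurable_funD; exact: measurable_funeM.
Qed.

Section representation.
Context d (Omega : measurableType d) (Pr : probability Omega R).
Variable Z : nat -> Omega -> T.
Hypothesis mZ : forall k, measurable_fun setT (Z k).
Hypothesis indZ : mutually_independent Pr Z.
Hypothesis lawZ : forall n A, measurable A -> Pr (Z n @^-1` A) = mu A.

Lemma integral_backwardS n f x : measurable_fun setT f -> (forall x, 0 <= f x) ->
  \int[Pr]_w f (backward F Z n.+1 w x) =
  \int[mu]_z \int[Pr]_w f (backward F Z n w (F (x, z))).
Proof.
move=> mf f0 /=.
rewrite (integral_past_fresh mZ indZ lawZ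
  (h := fun wz => f (backward F Z n wz.1 (F (x, wz.2)))))//.
apply: (measurableT_comp mf).
have mB := measurable_backward2 mF n
  (fun k (kn : (k < n)%N) => measurable_past Z kn).
apply: (measurableT_comp mB (g := fun wz => (wz.1, F (x, wz.2)))).
apply: measurable_fun_pair; first exact: measurable_fst.
by apply: (measurableT_comp (mF1 x)); exact: measurable_snd.
Qed.

(** Conditioning on the innovation that is applied first turns one step of the
    backward iteration into one application of the transition operator. *)
Lemma integral_backward n f x : measurable_fun setT f -> (forall x, 0 <= f x) ->
  \int[Pr]_w f (backward F Z n w x) = iter n transition f x.
Proof.
move=> mf f0; elim: n x => [|n IH] x.
  by rewrite /= integral_cst//= probability_setT mule1.
by rewrite integral_backwardS//; apply: eq_integral => z _; rewrite IH.
Qed.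

End representation.

End transition_operator.
Arguments transition {dE E dT T R} F mu f x.

(** * Powers, exponentials and the pointwise drift inequality *)

Section powers_and_exponentials.
Context {R : realType}.
Implicit Types a s t th eta y q W M : R.

(** Concavity of the logarithm at 1 + th (a - 1) = th a + (1 - th). *)
Lemma powR_bernoulli a th : 0 <= a -> 0 < th <= 1 -> a `^ th <= 1 + th * (a - 1).
Proof.
move=> a0 /andP[th0 th1]; have [->|a_neq0] := eqVneq a 0.
  by rewrite powR0 ?gt_eqF//; lra.
have {a0}a0 : 0 < a by rewrite lt_neqAle eq_sym a_neq0.
set m := 1 + _.
have m0 : 0 < m.
  have -> : m = (1 - th) + th * a by rewrite /m; ring.
  by rewrite ltr_wpDl ?mulr_gt0// subr_ge0.
have lnle (u : R) : 0 < u -> ln u <= u - 1.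
  by move=> u0; rewrite -[X in ln X](subrKC 1) le_ln1Dx//; lra.
rewrite /powR gt_eqF// -[leRHS]lnK ?posrE// ler_expR.
have h1 := lnle (a / m) (divr_gt0 a0 m0).
have h2 : ln m^-1 <= m^-1 - 1 by apply: lnle; rewrite invr_gt0.
rewrite ln_div ?posrE// in h1; rewrite lnV ?posrE// in h2.
have {}h1 := ler_wpM2l (ltW th0) h1.
have {}h2 : (1 - th) * (- ln m) <= (1 - th) * (m^-1 - 1).
  by apply: ler_wpM2l => //; rewrite subr_ge0.
have h3 : th * (a / m - 1) + (1 - th) * (m^-1 - 1) = 0.
  by rewrite /m; field; rewrite -/m; move: m0; rewrite /m; lra.
lra.
Qed.

(** The tangent bound for y ^ s as a concave function of y ^ 2: squares of
    norms expand exactly, norms do not. *)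
Lemma powR_le_tangent_sqr y t s : 0 <= y -> 0 < t -> 0 < s <= 2 ->
  y `^ s <= t `^ s + s / 2 * t `^ (s - 2) * (y ^+ 2 - t ^+ 2).
Proof.
move=> y0 t0 /andP[s0 s2].
have t20 : 0 < t ^+ 2 by rewrite exprn_gt0.
have -> : y `^ s = t `^ s * (y ^+ 2 / t ^+ 2) `^ (s / 2).
  rewrite -expr_div_n -(@powR_mulrn _ (y / t)) ?divr_ge0 ?(ltW t0)//.
  rewrite -powRrM (_ : 2%:R * (s / 2) = s); last by field.
  by rewrite -powRM ?divr_ge0 ?(ltW t0)// mulrC divfK// gt_eqF.
have h : (y ^+ 2 / t ^+ 2) `^ (s / 2) <= 1 + s / 2 * (y ^+ 2 / t ^+ 2 - 1).
  by apply: powR_bernoulli; [rewrite divr_ge0 ?sqr_ge0|apply/andP; split; lra].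
apply: (le_trans (ler_wpM2l (powR_ge0 t s) h)).
have -> : t `^ (s - 2) = t `^ s / t ^+ 2.
  rewrite powRB; last by rewrite (gt_eqF t0) implybT.
  by rewrite -(powR_mulrn 2 (ltW t0)).
rewrite le_eqVlt; apply/orP; left; apply/eqP; field.
by rewrite gt_eqF.
Qed.

Lemma powR_subadditive y q s : 0 <= y -> 0 <= q -> 0 < s <= 1 ->
  (y + q) `^ s <= y `^ s + q `^ s.
Proof.
move=> y0 q0 /andP[s0 s1].
have [yq0|yq0] := eqVneq (y + q) 0.
  by rewrite yq0 powR0 ?gt_eqF// addr_ge0 ?powR_ge0.
have yq : 0 < y + q by rewrite lt_neqAle eq_sym yq0 addr_ge0.
have key (a : R) : 0 <= a -> a <= y + q -> a / (y + q) * (y + q) `^ s <= a `^ s.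
  move=> a0 ale; have [->|aneq0] := eqVneq a 0.
    by rewrite mul0r mul0r powR_ge0.
  have ap : 0 < a by rewrite lt_neqAle eq_sym aneq0.
  rewrite [X in _ <= X `^ _](_ : a = a / (y + q) * (y + q)); last by rewrite divfK.
  rewrite powRM ?divr_ge0 ?(ltW yq)//; apply: ler_wpM2r; first exact: powR_ge0.
  by apply: ger1_powR => //; rewrite divr_gt0//= ler_pdivrMr// mul1r.
have -> : (y + q) `^ s = y / (y + q) * (y + q) `^ s + q / (y + q) * (y + q) `^ s.
  by rewrite -mulrDl -mulrDl divff// mul1r.
by rewrite lerD// key// ?lerDl ?lerDr.
Qed.

(** From u <= exp u at u = eta y / a, raised to the power a. *)
Lemma powR_le_expR a eta y : 0 < a -> 0 < eta -> 0 <= y ->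
  y `^ a <= (a / eta) `^ a * expR (eta * y).
Proof.
move=> a0 eta0 y0.
rewrite [in leLHS](_ : y = (a / eta) * (eta * y / a)); last first.
  by field; rewrite !gt_eqF.
have h0 : 0 <= eta * y / a by rewrite divr_ge0 ?mulr_ge0 ?(ltW eta0) ?(ltW a0).
have h1 : 0 <= a / eta by rewrite divr_ge0 ?(ltW eta0) ?(ltW a0).
rewrite (powRM _ h1 h0).
apply: ler_wpM2l; first exact: powR_ge0.
rewrite [X in expR X](_ : _ = (eta * y / a) * a); last by rewrite divfK ?gt_eqF.
rewrite expRM; apply: ge0_ler_powR; rewrite ?nnegrE ?expR_ge0 ?h0 ?(ltW a0)//.
by rewrite (le_trans _ (expR_ge1Dx _))// lerDr.
Qed.

Lemma expR_le_quadratic W M : 0 <= M -> W <= M ->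
  expR W <= 1 + W + W ^+ 2 * expR M.
Proof.
move=> M0 WM.
have h1 : expR W - 1 <= W * expR W.
  have := expR_ge1Dx (- W); move/(ler_wpM2r (expR_ge0 W)).
  by rewrite -expRD addNr expR0; lra.
have := expR_ge1Dx W => h2.
have [W0|W0] := leP 0 W.
  have : W * expR W <= W * (1 + W * expR W) by apply: ler_wpM2l => //; lra.
  have : W ^+ 2 * expR W <= W ^+ 2 * expR M.
    by rewrite ler_wpM2l ?sqr_ge0// ler_expR.
  by rewrite expr2; lra.
have : W * expR W <= W * (1 + W) by rewrite ler_nM2l.
have : W ^+ 2 * 1 <= W ^+ 2 * expR M.
  by rewrite ler_wpM2l ?sqr_ge0// (le_trans _ (expR_ge1Dx _))// lerDl.
by rewrite expr2; lra.
Qed.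

End powers_and_exponentials.

Section drift_increment.
Context {R : realType}.

(** The drift inequality before integration. Here t is the norm of the current
    state, v that of its image, q that of the innovation, i their inner product
    and y the norm of the next state. The gain b (s r / 2) t ^ (s - rho) is
    linear in b; the inner product, which integrates to zero for centred
    innovations, is kept exactly; everything else is either quadratic in b or
    of the smaller order t ^ (s - 2). *)
Lemma drift_pointwise (s rho r b t v q i y : R) :
  0 < s <= 1 -> s <= rho -> s + rho <= 2 -> 0 < r -> 0 < b <= 1 -> 1 <= t ->
  0 <= v <= t * (1 - r * t `^ (- rho)) -> 0 <= q -> `|i| <= v * q ->
  0 <= y <= v + q -> y ^+ 2 = v ^+ 2 + 2 * i + q ^+ 2 ->
  expR (b * (y `^ s - t `^ s)) <=
    1 - b * (s * r / 2) * t `^ (s - rho) + b * s * t `^ (s - 2) * i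
    + (3 * t `^ (s - 2) + (6 + r ^+ 2) * b ^+ 2 * t `^ (s - rho))
      * ((1 + q ^+ 2) * expR (2 * b * q `^ s)).
Proof.
move=> /andP[s0 s1] srho srho2 r0 /andP[b0 b1] t1 /andP[v0 vt] q0 ivq
  /andP[y0 yvq] y2.
have t0 : 0 < t by exact: lt_le_trans t1.
set tau := t `^ (s - rho); set kap := t `^ (s - 2).
have tau0 : 0 < tau by exact: powR_gt0.
have kap0 : 0 < kap by exact: powR_gt0.
have kapE : kap * t ^+ 2 = t `^ s.
  rewrite /kap -(powR_mulrn 2 (ltW t0)) -powRD ?subrK//.
  by rewrite (gt_eqF t0) implybT.
have ts1 : 1 <= t `^ s by rewrite -(powRr0 t) ler_powR// ltW.
have tauE : kap * (t ^+ 2 * t `^ (- rho)) = tau.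
  by rewrite mulrA kapE -powRD// (gt_eqF t0) implybT.
have tau1 : tau <= 1 by rewrite -(powRr0 t) ler_powR// subr_le0.
have kaptau : (kap * t) ^+ 2 <= tau.
  have -> : (kap * t) ^+ 2 = kap * t `^ s by rewrite -kapE; ring.
  by rewrite /kap -powRD ?(gt_eqF t0) ?implybT// ler_powR//; lra.
set w := r * t `^ (- rho) in vt *.
have w0 : 0 <= w by rewrite mulr_ge0 ?powR_ge0 ?ltW.
have w1 : w <= 1.
  rewrite leNgt; apply/negP => w1.
  have : t * (1 - w) < 0 by rewrite pmulr_rlt0// subr_lt0.
  by rewrite ltNge (le_trans v0 vt).
have vlet : v <= t by rewrite (le_trans vt)// ger_pMr//; lra.
have v2 : v ^+ 2 <= t ^+ 2 * (1 - w).
  have : v ^+ 2 <= (t * (1 - w)) ^+ 2 by rewrite lerXn2r ?nnegrE// (le_trans v0).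
  move=> /le_trans; apply; rewrite exprMn ler_wpM2l ?sqr_ge0// expr2.
  by rewrite ler_piMr ?subr_ge0//; lra.
have rtau : kap * t ^+ 2 * w = r * tau by rewrite -tauE /w; ring.
have itq : `|i| <= t * q by rewrite (le_trans ivq)// ler_wpM2r.
have [i1 i2] : - (t * q) <= i /\ i <= t * q.
  by move: itq; rewrite ler_norml => /andP[].
set A := b * (s * r / 2) * tau.
have [s0' b0' r0' t0'] : [/\ 0 <= s, 0 <= b, 0 <= r & 0 <= t] by rewrite !ltW.
have [tau0' kap0'] : 0 <= tau /\ 0 <= kap by rewrite !ltW.
set B := 3 * kap + _.
have c0 : 0 <= 6 + r ^+ 2 by rewrite addr_ge0 ?sqr_ge0.
have B0 : 0 <= B.
  apply: addr_ge0; first by rewrite mulr_ge0// ltW.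
  by apply: mulr_ge0; [apply: mulr_ge0 => //; exact: sqr_ge0|exact: ltW].
set Y := b * s * kap * i + b * (s / 2) * kap * q ^+ 2.
have bs0 : 0 < b * s by rewrite mulr_gt0.
have bs1 : b * s <= 1 by rewrite mulr_ile1.
have AE : A = b * s / 2 * (kap * t ^+ 2 * w) by rewrite rtau /A; field.
have A0 : 0 <= A by rewrite AE rtau !mulr_ge0 ?invr_ge0.
set M := 2 * b * q `^ s.
have M0 : 0 <= M by rewrite !mulr_ge0 ?powR_ge0.
have eM1 : 1 <= expR M by rewrite (le_trans _ (expR_ge1Dx _))// lerDl.
have [qt|tq] := leP q t.
- (* q <= t: the increment is at most - A + Y, whose positive part is dominated
     by M because t ^ (s - 1) q <= q ^ s. *)
  have WAY : b * (y `^ s - t `^ s) <= - A + Y.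
    have h : y `^ s <= t `^ s + s / 2 * kap * (y ^+ 2 - t ^+ 2).
      by apply: powR_le_tangent_sqr => //; apply/andP; split; lra.
    have : y `^ s - t `^ s <= s / 2 * kap * (- (t ^+ 2 * w) + 2 * i + q ^+ 2).
      rewrite lerBlDl (le_trans h)// lerD2l ler_wpM2l//; last by rewrite y2; lra.
      by rewrite mulr_ge0 ?divr_ge0.
    move=> /(ler_wpM2l (ltW b0)) /le_trans; apply.
    by rewrite AE /Y le_eqVlt; apply/orP; left; apply/eqP; field.
  have ktq : kap * t * q <= q `^ s.
    have [->|qneq0] := eqVneq q 0; first by rewrite mulr0 powR_ge0.
    have qp : 0 < q by rewrite lt_neqAle eq_sym qneq0.
    have -> : kap * t * q = t `^ s * (q / t).
      by rewrite -kapE; field; rewrite gt_eqF.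
    have -> : q `^ s = t `^ s * (q / t) `^ s.
      by rewrite -powRM ?divr_ge0// mulrC divfK// gt_eqF.
    rewrite ler_pM2l ?powR_gt0//.
    by apply: ger1_powR => //; rewrite divr_gt0//= ler_pdivrMr// mul1r.
  set k := kap * t * q in ktq.
  have k0 : 0 <= k by rewrite !mulr_ge0.
  have k2 : k ^+ 2 <= tau * q ^+ 2 by rewrite /k exprMn ler_wpM2r ?sqr_ge0.
  have kq2 : kap * q ^+ 2 <= k by rewrite expr2 /k -!mulrA ler_pM2l// ler_wpM2r.
  have kq0 : 0 <= kap * q ^+ 2 by rewrite mulr_ge0 ?sqr_ge0.
  have kti1 : kap * i <= k by rewrite /k -!mulrA ler_pM2l.
  have kti2 : - k <= kap * i by rewrite /k -!mulrA -mulrN ler_pM2l.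
  set X := kap * i + kap * q ^+ 2 / 2.
  have YX : Y = b * s * X by rewrite /Y /X; field.
  have Xk : `|X| <= 3 / 2 * k by rewrite /X ler_norml; apply/andP; split; lra.
  have Yk : `|Y| <= b * (3 / 2 * k).
    rewrite YX normrM (gtr0_norm bs0) -(mulrA b s) ler_pM2l//.
    by rewrite (le_trans _ Xk)// ler_piMl.
  have YM : - A + Y <= M.
    have : b * (3 / 2 * k) <= M.
      rewrite /M [2 * b]mulrC -(mulrA b 2) ler_pM2l//.
      by have := powR_ge0 q s; lra.
    by have := le_trans (ler_norm _) Yk; lra.
  apply: (@le_trans _ _ (expR (- A + Y))); first by rewrite ler_expR.
  apply: (le_trans (expR_le_quadratic M0 YM)).
  have AY2 : (- A + Y) ^+ 2 <= (6 + r ^+ 2) * b ^+ 2 * tau * (1 + q ^+ 2).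
    have : (- A + Y) ^+ 2 <= 2 * A ^+ 2 + 2 * Y ^+ 2.
      by have := sqr_ge0 (A + Y); rewrite !sqrrD sqrrN; lra.
    have Y2 : Y ^+ 2 <= 9 / 4 * (b ^+ 2 * (tau * q ^+ 2)).
      rewrite -[Y ^+ 2]real_normK ?num_real//.
      apply: (@le_trans _ _ ((b * (3 / 2 * k)) ^+ 2)).
        by rewrite lerXn2r ?nnegrE// (le_trans (normr_ge0 Y)).
      rewrite (_ : _ ^+ 2 = 9 / 4 * (b ^+ 2 * k ^+ 2)); last by field.
      by rewrite ler_pM2l// ler_pM2l// exprn_gt0.
    have A2 : A ^+ 2 <= b ^+ 2 * (r ^+ 2 * tau) / 4.
      have -> : A ^+ 2 = b ^+ 2 * (r ^+ 2 * tau) / 4 * (s ^+ 2 * tau).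
        by rewrite /A; field.
      rewrite ler_piMr//; last first.
        by rewrite mulr_ile1 ?sqr_ge0 ?exprn_ile1.
      by rewrite divr_ge0// !mulr_ge0.
    have ? : 0 <= b ^+ 2 * tau by rewrite mulr_ge0 ?sqr_ge0.
    have ? : 0 <= b ^+ 2 * (r ^+ 2 * tau).
      by rewrite !mulr_ge0.
    have ? : 0 <= b ^+ 2 * (tau * q ^+ 2).
      by rewrite !mulr_ge0.
    have ? : 0 <= b ^+ 2 * (r ^+ 2 * (tau * q ^+ 2)).
      by rewrite !mulr_ge0.
    lra.
  have {AY2} := ler_wpM2r (expR_ge0 M) AY2.
  set m := (1 + q ^+ 2) * expR M.
  have : kap * q ^+ 2 <= kap * m.
    rewrite ler_pM2l// /m (@le_trans _ _ ((1 + q ^+ 2) * 1))//; last first.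
      by rewrite ler_wpM2l// addr_ge0// sqr_ge0.
    by rewrite mulr1 lerDr.
  have : b * (s / 2) * kap * q ^+ 2 <= kap * q ^+ 2.
    have -> : b * (s / 2) * kap * q ^+ 2 = (b * s / 2) * (kap * q ^+ 2) by field.
    by rewrite ler_piMl//; lra.
  by rewrite mulrDl -/B /B /m /Y; lra.
- (* q > t: the increment is only bounded by q ^ s, but 1 <= kap * q ^+ 2, so
     the last term pays for everything. *)
  have yq : y `^ s - t `^ s <= q `^ s.
    rewrite lerBlDl (@le_trans _ _ ((v + q) `^ s))//.
      by apply: ge0_ler_powR; rewrite ?nnegrE// addr_ge0.
    rewrite (le_trans (powR_subadditive v0 q0 _)) ?s0//= lerD2r.
    by apply: ge0_ler_powR; rewrite ?nnegrE// ltW.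
  have eb : expR (b * (y `^ s - t `^ s)) <= expR M.
    rewrite ler_expR; apply: (le_trans (ler_wpM2l (ltW b0) yq)).
    by have := mulr_ge0 (ltW b0) (powR_ge0 q s); rewrite /M -mulrA; lra.
  apply: (le_trans eb).
  have K1 : kap * t ^+ 2 <= kap * q ^+ 2 by rewrite ler_pM2l// lerXn2r ?nnegrE// ltW.
  have K2 : kap * (t * q) <= kap * q ^+ 2.
    by rewrite ler_pM2l// expr2 ler_wpM2r// ltW.
  have K3 : 1 <= kap * q ^+ 2 by rewrite (le_trans _ K1)// kapE.
  have AK : A <= kap * q ^+ 2.
    rewrite AE -[leRHS]mul1r ler_pM//; [by rewrite divr_ge0// ltW| |lra|].
      by rewrite rtau mulr_ge0.
    by rewrite (le_trans _ K1)// ler_piMr// kapE powR_ge0.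
  have iK : - (kap * q ^+ 2) <= b * s * kap * i.
    have h : - (kap * (t * q)) <= kap * i by rewrite -mulrN ler_pM2l.
    have : - (kap * q ^+ 2) <= kap * i by lra.
    rewrite -[b * s * kap * i]mulrA.
    have [i0|/ltW i0] := leP 0 i.
      move=> _; apply: (@le_trans _ _ 0); first by rewrite oppr_le0; lra.
      by rewrite !mulr_ge0 ?(ltW bs0).
    by move=> /le_trans; apply; rewrite -[leLHS]mul1r ler_wnM2r// pmulr_rle0.
  have : 3 * kap * (q ^+ 2 * expR M) <= B * ((1 + q ^+ 2) * expR M).
    apply: ler_pM.
    + by rewrite mulr_ge0.
    + by rewrite mulr_ge0 ?sqr_ge0 ?expR_ge0.
    + by rewrite /B lerDl !mulr_ge0.
    + by rewrite ler_wpM2r ?expR_ge0// lerDr.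
  have : kap * q ^+ 2 * (expR M - 1) >= 1 * (expR M - 1).
    by rewrite ler_wpM2r// subr_ge0.
  lra.
Qed.

End drift_increment.

(** * Lyapunov drift of the autoregressive kernel *)

Section lipschitz_measurability.
Context {R : realType} {p : nat}.

Lemma enorm_le_sup (x : 'rV[R]_p) (e : R) :
  0 <= e -> (forall i, `|x 0 i| <= e) -> enorm x <= p%:R * e.
Proof.
move=> e0 xe; rewrite -ler_sqr ?nnegrE ?enorm_ge0 ?mulr_ge0// enorm_sqr.
apply: (@le_trans _ _ (\sum_(i < p) e ^+ 2)).
  apply: ler_sum => i _; rewrite -[x 0 i ^+ 2]real_normK ?num_real//.
  by rewrite lerXn2r ?nnegrE.
rewrite sumr_const card_ord -[leLHS]mulr_natl exprMn ler_wpM2r ?sqr_ge0//.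
by rewrite -natrX ler_nat; case: (p) => // k; rewrite leq_pmulr.
Qed.

(** The topology is that of the sup norm, hence the comparison of norms. *)
Lemma enorm_open (U : set 'rV[R]_p) :
  (forall x, U x -> exists2 e, 0 < e & forall y, enorm (x - y) < e -> U y) ->
  open U.
Proof.
move=> hU; rewrite openE => x /hU[e e0 xU]; apply/nbhs_ballP.
have p1 : 0 < p.+1%:R :> R by rewrite ltr0n.
exists (e / p.+1%:R); first by rewrite /= divr_gt0.
move=> y /ball_rVP; rewrite divr_gt0// => /(_ isT) xy; apply: xU.
apply: (@le_lt_trans _ _ (p%:R * (e / p.+1%:R))).
  apply: enorm_le_sup => [|i]; first by rewrite divr_ge0// ltW.
  by rewrite !mxE ltW.
by rewrite mulrCA gtr_pMr// ltr_pdivrMr// mul1r ltr_nat.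
Qed.

Definition elipschitz (K : R) (h : 'rV[R]_p -> R) :=
  forall x y, `|h x - h y| <= K * enorm (x - y).

Lemma elipschitz_measurable K h : elipschitz K h -> measurable_fun setT h.
Proof.
move=> hK; apply: (measurability _ (RGenOpens.measurableE R)).
move=> _ [_ [a [b ->] <-]]; rewrite setTI.
apply: sub_sigma_algebra; apply: enorm_open => x /=; rewrite in_itv/= => /andP[ax xb].
have K1 : 0 < `|K| + 1 by rewrite ltr_wpDl.
pose m := Num.min (h x - a) (b - h x).
have m0 : 0 < m by rewrite lt_min !subr_gt0 ax xb.
exists (m / (`|K| + 1)); first by rewrite divr_gt0.
move=> y; rewrite ltr_pdivlMr// => xym.
have : `|h x - h y| < m.
  apply: le_lt_trans xym; apply: (le_trans (hK x y)).
  rewrite mulrC ler_wpM2l ?enorm_ge0// (le_trans (ler_norm _))// lerDl.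
  exact: ler01.
rewrite lt_min !ltr_norml => /andP[/andP[_ h1] /andP[h2 _]].
by rewrite in_itv/=; apply/andP; split; lra.
Qed.

Lemma nonexpansive_measurable (g : 'rV[R]_p -> 'rV[R]_p) :
  (forall x y, enorm (g x - g y) <= enorm (x - y)) -> measurable_fun setT g.
Proof.
move=> hg; apply: measurable_fun_rV => i.
apply: (@elipschitz_measurable 1) => x y; rewrite mul1r.
rewrite (le_trans _ (hg x y))// (le_trans _ (coord_le_enorm _ i))//.
by rewrite !mxE.
Qed.

End lipschitz_measurability.

Section integral_comparison.
Context d (T : measurableType d) {R : realType} (mu : {measure set T -> \bar R}).
Local Open Scope ereal_scope.

Lemma le_integral_scale (C : R) (f h : T -> R) : (0 <= C)%R ->
  measurable_fun setT f -> measurable_fun setT h ->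
  (forall x, 0 <= f x)%R -> (forall x, 0 <= h x)%R ->
  (forall x, f x <= C * h x)%R ->
  \int[mu]_x (f x)%:E <= C%:E * \int[mu]_x (h x)%:E.
Proof.
move=> C0 mf mh f0 h0 fh.
have mh' : measurable_fun setT (EFin \o h) by exact/measurable_EFinP.
have h0' x : setT x -> 0 <= (EFin \o h) x by rewrite /= lee_fin.
rewrite -(@ge0_integralZl_EFin _ _ _ mu setT measurableT _ h0' mh' C C0).
apply: ge0_le_integral => //.
- by move=> x _; rewrite lee_fin.
- exact/measurable_EFinP.
- exact: measurable_funeM.
- by move=> x _ /=; rewrite -EFinM lee_fin.
Qed.

End integral_comparison.

Section innovation_moments.
Context {R : realType} {p : nat} (mu : probability 'rV[R]_p R).
Variables (beta0 kappa0 : R).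
Hypothesis beta0_gt0 : 0 < beta0.
Hypothesis kappa0_01 : 0 < kappa0 <= 1.
Hypothesis exp_moment :
  (\int[mu]_z (expR (beta0 * enorm z `^ kappa0))%:E < +oo)%E.

(** The weight of the remainder term in [drift_pointwise]. *)
Definition moment_weight (b s : R) (z : 'rV[R]_p) : R :=
  (1 + enorm z ^+ 2) * expR (2 * b * enorm z `^ s).

Lemma measurable_expR_enorm (b s : R) :
  measurable_fun setT (fun z : 'rV[R]_p => expR (b * enorm z `^ s)).
Proof.
apply: measurableT_comp => //; apply: measurable_funM => //.
exact: (measurableT_comp (measurable_powR _) measurable_enorm).
Qed.

Lemma measurable_moment_weight b s : measurable_fun setT (moment_weight b s).
Proof.
apply: measurable_funM; last exact: measurable_expR_enorm.
apply: measurable_funD => //; apply: measurable_funX; exact: measurable_enorm.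
Qed.

Lemma moment_weight_ge1 b s z : 0 <= b -> 1 <= moment_weight b s z.
Proof.
move=> b0; rewrite /moment_weight -[leLHS]mulr1 ler_pM//.
  by rewrite lerDl sqr_ge0.
by rewrite (le_trans _ (expR_ge1Dx _))// lerDl !mulr_ge0// powR_ge0.
Qed.

(** The bound is uniform in b, so that b can be chosen after it. For b at most
    beta0 / 4 the exponential in the weight costs half of the exponential
    moment, and the polynomial factor fits in the other half. *)
Lemma moment_weight_bound (s : R) : 0 < s <= kappa0 ->
  exists2 G : R, 0 < G & forall b : R, 0 < b -> b <= beta0 / 4 ->
    (\int[mu]_z (moment_weight b s z)%:E <= G%:E)%E.
Proof.
move=> /andP[s0 sk]; have /andP[k0 k1] := kappa0_01.
pose C := expR (beta0 / 2) * (1 + (2 / kappa0 / (beta0 / 2)) `^ (2 / kappa0)).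
have C0 : 0 < C by rewrite mulr_gt0 ?expR_gt0// ltr_pwDl// powR_ge0.
have Ioo := exp_moment; set I := (\int[mu]_z _)%E in Ioo.
have I0 : (0 <= I)%E by apply: integral_ge0 => z _; rewrite lee_fin expR_ge0.
have If : I = (fine I)%:E by rewrite fineK// ge0_fin_numE.
exists (C * (fine I + 1)).
  by rewrite mulr_gt0// ltr_pwDr// fine_ge0.
move=> b b0 bb.
apply: (@le_trans _ _ (C%:E * I)%E); last first.
  by rewrite If -EFinM lee_fin ler_pM2l// lerDl.
apply: le_integral_scale.
- exact: ltW.
- exact: measurable_moment_weight.
- exact: measurable_expR_enorm.
- by move=> z; rewrite (le_trans ler01)// moment_weight_ge1// ltW.
- by move=> z; exact: expR_ge0.
move=> z; rewrite /moment_weight; set q := enorm z.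
have q0 : 0 <= q := enorm_ge0 z.
have qk0 : 0 <= q `^ kappa0 := powR_ge0 _ _.
have qs : q `^ s <= 1 + q `^ kappa0.
  have [q1|q1] := leP q 1.
    apply: (@le_trans _ _ 1); last by rewrite lerDl.
    rewrite [leRHS](_ : 1 = 1 `^ s); last by rewrite powR1.
    by apply: ge0_ler_powR; rewrite ?nnegrE ?(ltW s0).
  apply: (@le_trans _ _ (q `^ kappa0)); last by rewrite lerDr.
  by apply: ler_powR => //; exact: ltW.
have e1 : expR (2 * b * q `^ s) <=
    expR (beta0 / 2) * expR (beta0 / 2 * q `^ kappa0).
  rewrite -expRD ler_expR -[X in X + _]mulr1 -mulrDr ler_pM//.
  - by rewrite mulr_ge0// ltW.
  - exact: powR_ge0.
  - by rewrite mulrC -ler_pdivlMr//; lra.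
have e2 : 1 + q ^+ 2 <= (1 + (2 / kappa0 / (beta0 / 2)) `^ (2 / kappa0))
    * expR (beta0 / 2 * q `^ kappa0).
  rewrite mulrDl mul1r lerD//.
    by rewrite (le_trans _ (expR_ge1Dx _))// lerDl mulr_ge0// divr_ge0// ltW.
  have := @powR_le_expR _ (2 / kappa0) (beta0 / 2) (q `^ kappa0).
  rewrite -powRrM (_ : kappa0 * (2 / kappa0) = 2%:R); last by field; rewrite gt_eqF.
  by rewrite powR_mulrn//; apply; rewrite ?divr_gt0.
have -> : C * expR (beta0 * q `^ kappa0) =
    (1 + (2 / kappa0 / (beta0 / 2)) `^ (2 / kappa0)) * expR (beta0 / 2 * q `^ kappa0)
    * (expR (beta0 / 2) * expR (beta0 / 2 * q `^ kappa0)).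
  have -> : expR (beta0 * q `^ kappa0) =
      expR (beta0 / 2 * q `^ kappa0) * expR (beta0 / 2 * q `^ kappa0).
    by rewrite -expRD; congr expR; field.
  by rewrite /C; ring.
by rewrite ler_pM ?addr_ge0 ?sqr_ge0 ?expR_ge0 ?ler01.
Qed.

End innovation_moments.

Section kernel_drift.
Context {R : realType} {p : nat} (mu : probability 'rV[R]_p R).
Variable g : 'rV[R]_p -> 'rV[R]_p.
Hypothesis g_nonexp : forall x y, enorm (g x - g y) <= enorm (x - y).
Variables (beta0 kappa0 : R).
Hypothesis beta0_gt0 : 0 < beta0.
Hypothesis kappa0_01 : 0 < kappa0 <= 1.
Hypothesis exp_moment :
  (\int[mu]_z (expR (beta0 * enorm z `^ kappa0))%:E < +oo)%E.
Hypothesis centered : forall i, (\int[mu]_z (z 0 i)%:E = 0)%E.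
Variables (s rho r M0 : R).
Hypothesis s_gt0 : 0 < s.
Hypothesis s_le : s <= kappa0.
Hypothesis s_rho : s <= rho.
Hypothesis s_rho2 : s + rho <= 2.
Hypothesis rho2 : rho < 2.
Hypothesis r_gt0 : 0 < r.
Hypothesis g_drift : forall x, M0 <= enorm x ->
  enorm (g x) <= enorm x * (1 - r * enorm x `^ (- rho)).

Definition lyap (b : R) (x : 'rV[R]_p) : R := expR (b * enorm x `^ s).

Lemma integrable_edot u (b : R) (G : R) : 0 < b ->
  (\int[mu]_z (moment_weight b s z)%:E <= G%:E)%E ->
  mu.-integrable setT (fun z => (edot u z)%:E) /\
  (\int[mu]_z (edot u z)%:E = 0)%E.
Proof.
move=> b0 hG.
have icoord i : mu.-integrable setT (fun z : 'rV[R]_p => (z 0 i)%:E).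
  have mw : mu.-integrable setT (EFin \o moment_weight b s).
    apply/integrableP; split.
      by apply/measurable_EFinP; exact: measurable_moment_weight.
    apply: le_lt_trans (ltry G); apply: le_trans hG.
    under eq_integral do rewrite gee0_abs ?lee_fin
      ?(le_trans ler01) ?moment_weight_ge1 ?(ltW b0)//.
    exact: lexx.
  apply: (le_integrable _ _ _ mw) => //.
    by apply/measurable_EFinP; exact: measurable_coord.
  move=> z _ /=; rewrite lee_fin (le_trans (coord_le_enorm z i))//.
  rewrite (le_trans _ (ler_norm _))// /moment_weight.
  have q0 := enorm_ge0 z.
  apply: (@le_trans _ _ ((1 + enorm z ^+ 2) * 1)).
    by rewrite mulr1; have := sqr_ge0 (enorm z - 1); rewrite sqrrB; lra.
  rewrite ler_wpM2l ?addr_ge0 ?sqr_ge0//.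
  by rewrite (le_trans _ (expR_ge1Dx _))// lerDl !mulr_ge0// ?powR_ge0// ltW.
have isum : forall i, mu.-integrable setT (fun z : 'rV[R]_p => (u 0 i * z 0 i)%:E).
  by move=> i; under eq_fun do rewrite EFinM; exact: integrableZl.
rewrite /edot; under eq_fun do rewrite -sumEFin.
split; first exact: integrable_sum.
rewrite integral_sum//= big1// => i _.
by under eq_integral do rewrite EFinM; rewrite integralZl// centered mule0.
Qed.

Lemma lyap_ge1 b x : 0 <= b -> 1 <= lyap b x.
Proof.
move=> b0; rewrite (le_trans _ (expR_ge1Dx _))// lerDl mulr_ge0//.
exact: powR_ge0.
Qed.

Let mgz x : measurable_fun setT (fun z : 'rV[R]_p => g x + z).
Proof. exact: measurable_rVD. Qed.

Let s1 : 0 < s <= 1.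
Proof. by rewrite s_gt0 (le_trans s_le)//; case/andP: kappa0_01. Qed.

(** Subadditivity of t ^ s; useful only where the state is bounded. *)
Lemma lyap_growth b G x : 0 < b ->
  (\int[mu]_z (moment_weight b s z)%:E <= G%:E)%E ->
  (\int[mu]_z (lyap b (g x + z))%:E <= (lyap b (g x) * G)%:E)%E.
Proof.
move=> b0 hG; rewrite EFinM.
apply: (@le_trans _ _ ((lyap b (g x))%:E * \int[mu]_z (moment_weight b s z)%:E)%E);
  last by rewrite lee_wpmul2l// lee_fin expR_ge0.
apply: le_integral_scale.
- exact: expR_ge0.
- exact: (measurableT_comp (measurable_expR_enorm b s) (mgz x)).
- exact: measurable_moment_weight.
- by move=> z; exact: expR_ge0.
- by move=> z; rewrite (le_trans ler01)// moment_weight_ge1// ltW.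
move=> z; rewrite /lyap /moment_weight.
have h0 : 0 <= b * enorm z `^ s by rewrite mulr_ge0 ?powR_ge0// ltW.
apply: (@le_trans _ _ (expR (b * enorm (g x) `^ s) * (1 * expR (2 * b * enorm z `^ s)))).
  rewrite mul1r -expRD ler_expR -(mulrA 2).
  have : enorm (g x + z) `^ s <= enorm (g x) `^ s + enorm z `^ s.
    apply: le_trans (powR_subadditive (enorm_ge0 _) (enorm_ge0 _) s1).
    apply: ge0_ler_powR; rewrite ?nnegrE ?addr_ge0 ?enorm_ge0 ?(ltW s_gt0)//.
    exact: enorm_triangle.
  by move=> /(ler_wpM2l (ltW b0)); lra.
by rewrite ler_wpM2l ?expR_ge0// ler_wpM2r ?expR_ge0// lerDl sqr_ge0.
Qed.

(** Integrating [drift_pointwise]: the linear term disappears, the quadratic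
    one is beaten by the gain for b small, and the terms of order t ^ (s - 2)
    are beaten for t large, since rho < 2. *)
Theorem kernel_drift : exists2 b1 : R, 0 < b1 & forall b, 0 < b -> b <= b1 ->
  exists c M B : R, [/\ 0 < c, 0 < M, 0 < B,
    forall x, (\int[mu]_z (lyap b (g x + z))%:E <= (lyap b x + B)%:E)%E &
    forall x, M <= enorm x -> (\int[mu]_z (lyap b (g x + z))%:E <=
      (lyap b x * (1 - c * enorm x `^ (s - rho)))%:E)%E].
Proof.
have /andP[_ s1'] := s1.
have sk : 0 < s <= kappa0 by rewrite s_gt0.
have [G G0 hG] := moment_weight_bound beta0_gt0 kappa0_01 exp_moment sk.
have D0 : 0 < 6 + r ^+ 2 by rewrite ltr_pwDl// sqr_ge0.
pose b1 := Num.min (Num.min 1 (beta0 / 4)) (s * r / 8 / ((6 + r ^+ 2) * G)).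
exists b1.
  by rewrite !lt_min ltr01 !divr_gt0// mulr_gt0.
move=> b b0; rewrite !le_min => /andP[/andP[b1' bb] bG].
pose a := b * (s * r / 2).
have a0 : 0 < a by rewrite !mulr_gt0// invr_gt0.
have rho2' : 0 < 2 - rho by rewrite subr_gt0.
(* Beyond M the remainder 3 t^(s-2) G is at most (a / 4) t^(s-rho). *)
pose M := Num.max (Num.max 1 M0) ((12 * G / a) `^ (2 - rho)^-1).
have M1 : 1 <= M by rewrite !le_max lexx.
have M0' : 0 < M by exact: lt_le_trans M1.
have hdrift x : M <= enorm x -> (\int[mu]_z (lyap b (g x + z))%:E <=
      (lyap b x * (1 - a / 2 * enorm x `^ (s - rho)))%:E)%E.
  rewrite !ge_max => /andP[/andP[t1 tM0] tM].
  set t := enorm x in t1 tM0 tM *.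
  have t0 : 0 < t by exact: lt_le_trans t1.
  set tau := t `^ (s - rho); set kap := t `^ (s - 2).
  have tau0 : 0 < tau by exact: powR_gt0.
  have kapE : kap = tau * t `^ (rho - 2).
    by rewrite -powRD ?(gt_eqF t0) ?implybT//; congr (_ `^ _); ring.
  have kapG : 3 * kap * G <= a / 4 * tau.
    have hM : 12 * G / a <= t `^ (2 - rho).
      have : ((12 * G / a) `^ (2 - rho)^-1) `^ (2 - rho) <= t `^ (2 - rho).
        by apply: ge0_ler_powR; rewrite ?nnegrE ?powR_ge0 ?(ltW t0) ?(ltW rho2').
      rewrite -powRrM mulVf ?gt_eqF// powRr1// divr_ge0 ?(ltW a0)//.
      by rewrite mulr_ge0// ltW.
    have tN : t `^ (rho - 2) = (t `^ (2 - rho))^-1 by rewrite -powRN opprB.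
    have tp : 0 < t `^ (2 - rho) by exact: powR_gt0.
    rewrite kapE tN.
    rewrite ler_pdivrMr// in hM.
    rewrite -(ler_pM2r tp) (_ : _ * t `^ (2 - rho) = 3 * G * tau); last first.
      by field; rewrite gt_eqF.
    rewrite (_ : a / 4 * tau * _ = (t `^ (2 - rho) * a / 4) * tau); last by field.
    by rewrite ler_pM2r//; lra.
  have bDG : (6 + r ^+ 2) * b ^+ 2 * tau * G <= a / 4 * tau.
    rewrite ler_pdivlMr ?mulr_gt0// in bG.
    rewrite (_ : _ * tau * G = b * (b * ((6 + r ^+ 2) * G)) * tau); last by ring.
    rewrite ler_pM2r// (_ : a / 4 = b * (s * r / 8)); last by rewrite /a; field.
    by rewrite ler_pM2l.
  set B := 3 * kap + (6 + r ^+ 2) * b ^+ 2 * tau.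
  have B0 : 0 <= B.
    rewrite /B addr_ge0// ?mulr_ge0// ?powR_ge0// ?sqr_ge0//; exact: ltW.
  have [idot dot0] := integrable_edot (g x) b0 (hG _ b0 bb).
  have Vx : 0 < lyap b x by exact: expR_gt0.
  have imw : mu.-integrable setT (EFin \o moment_weight b s).
    apply/integrableP; split.
      by apply/measurable_EFinP; exact: measurable_moment_weight.
    apply: le_lt_trans (ltry G); apply: le_trans (hG _ b0 bb).
    under eq_integral do rewrite gee0_abs ?lee_fin
      ?(le_trans ler01) ?moment_weight_ge1 ?(ltW b0)//.
    exact: lexx.
  pose lin z := 1 - a * tau + b * s * kap * edot (g x) z.
  have ilin : mu.-integrable setT (EFin \o lin).
    rewrite (_ : EFin \o lin = (fun=> (1 - a * tau)%:E) \+
      (fun z => (b * s * kap)%:E * (edot (g x) z)%:E)%E); last exact/funext.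
    apply: integrableD => //; first exact: finite_measure_integrable_cst.
    exact: integrableZl.
  have Ilin : (\int[mu]_z (lin z)%:E = (1 - a * tau)%:E)%E.
    under eq_integral do rewrite EFinD EFinM.
    rewrite integralD//; [|exact: finite_measure_integrable_cst|exact: integrableZl].
    rewrite integralZl// dot0 mule0 adde0 integral_cst// [X in (_ * X)%E]probability_setT.
    by rewrite mule1.
  have key z : lyap b (g x + z) <= lyap b x * (lin z + B * moment_weight b s z).
    have -> : lyap b (g x + z) =
        lyap b x * expR (b * (enorm (g x + z) `^ s - t `^ s)).
      by rewrite /lyap -/t -expRD; congr expR; ring.
    rewrite ler_pM2l//.
    apply: (@drift_pointwise _ s rho r b t (enorm (g x)) (enorm z)
      (edot (g x) z) (enorm (g x + z))) => //.
    - by rewrite b0.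
    - by rewrite enorm_ge0 g_drift.
    - exact: enorm_ge0.
    - exact: Cauchy_Schwarz_edot.
    - by rewrite enorm_ge0 enorm_triangle.
    - exact: enormD_sqr.
  apply: (@le_trans _ _ (\int[mu]_z ((lyap b x)%:E *
      ((lin z)%:E + B%:E * (moment_weight b s z)%:E)))%E).
    apply: ge0_le_integral; first exact: measurableT.
    - by move=> z _; rewrite lee_fin expR_ge0.
    - apply/measurable_EFinP.
      exact: (measurableT_comp (measurable_expR_enorm b s) (mgz x)).
    - apply: measurable_funeM; apply: emeasurable_funD.
        exact: (measurable_int mu ilin).
      by apply: measurable_funeM; exact: (measurable_int mu imw).
    - move=> z _; have := key z.
      by rewrite -lee_fin (EFinM (lyap b x)) EFinD (EFinM B).
  rewrite integralZl//; last first.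
    by apply: integrableD => //; exact: integrableZl.
  rewrite integralD//; last exact: integrableZl.
  rewrite Ilin integralZl//.
  apply: (@le_trans _ _ ((lyap b x)%:E * ((1 - a * tau)%:E + B%:E * G%:E))%E).
    rewrite lee_wpmul2l ?lee_fin ?(ltW Vx)//.
    by rewrite leeD2l// lee_wpmul2l ?lee_fin// hG.
  rewrite -(EFinM B) -EFinD -(EFinM (lyap b x)) lee_fin ler_pM2l//.
  by rewrite /B mulrDl; lra.
exists (a / 2), M, (expR (b * (enorm (g 0) + M) `^ s) * G + 1); split => //.
- by rewrite divr_gt0.
- by rewrite ltr_wpDl// mulr_ge0 ?expR_ge0// ltW.
move=> x; have [Mx|xM] := leP M (enorm x).
  apply: (le_trans (hdrift x Mx)); rewrite lee_fin.
  apply: (@le_trans _ _ (lyap b x)).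
    by rewrite ger_pMr ?expR_gt0// gerBl mulr_ge0 ?powR_ge0// ltW// divr_gt0.
  by rewrite lerDl addr_ge0// mulr_ge0 ?expR_ge0// ltW.
apply: (le_trans (lyap_growth x b0 (hG _ b0 bb))); rewrite lee_fin.
have h : lyap b (g x) <= expR (b * (enorm (g 0) + M) `^ s).
  rewrite ler_expR ler_pM2l//; apply: ge0_ler_powR.
  - exact: ltW.
  - by rewrite nnegrE enorm_ge0.
  - by rewrite nnegrE addr_ge0 ?enorm_ge0// ltW.
  have := le_trans (enorm_lerB (g x) (g 0)) (g_nonexp x 0); rewrite subr0.
  by move: xM; lra.
rewrite (le_trans (ler_wpM2r (ltW G0) h))// addrCA lerDl addr_ge0//.
exact: expR_ge0.
Qed.

End kernel_drift.

(** * Synchronous coupling *)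

Section geometric_drift_with_error.
Context dE (E : measurableType dE) dT (T : measurableType dT) {R : realType}.
Variables (F : E * T -> E) (mu : probability T R).
Hypothesis mF : measurable_fun setT F.

(** The errors made at the successive steps are not discounted: they only
    accumulate linearly in n, while S itself grows at most by B per step. *)
Lemma iter_transition_contract (H S : E -> R) (eps delta B : R) :
  measurable_fun setT H -> measurable_fun setT S ->
  (forall x, 0 <= H x) -> (forall x, 0 <= S x) ->
  0 <= eps <= 1 -> 0 <= delta -> 0 <= B ->
  (forall x, transition F mu (EFin \o H) x <=
    ((1 - eps) * H x + delta * S x)%:E)%E ->
  (forall x, transition F mu (EFin \o S) x <= (S x + B)%:E)%E ->
  forall n x, (iter n (transition F mu) (EFin \o H) x <=
    ((1 - eps) ^+ n * H x + delta * n%:R * (S x + n%:R * B))%:E)%E.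
Proof.
move=> mH mS H0 S0 /andP[eps0 eps1] delta0 B0 QH QS.
have e0 : 0 <= 1 - eps by rewrite subr_ge0.
elim=> [x|n IH x] /=; first by rewrite mulr0 mul0r addr0 expr0 mul1r.
have mH' : measurable_fun setT (EFin \o H) by exact/measurable_EFinP.
have mS' : measurable_fun setT (EFin \o S) by exact/measurable_EFinP.
have H0' y : (0 <= (EFin \o H) y)%E by rewrite /= lee_fin.
have S0' y : (0 <= (EFin \o S) y)%E by rewrite /= lee_fin.
set a := (1 - eps) ^+ n; set b := delta * n%:R.
have a0 : 0 <= a by rewrite exprn_ge0.
have a1 : a <= 1 by rewrite exprn_ile1// lerBlDr lerDl.
have b0 : 0 <= b by rewrite mulr_ge0.
have c0 : 0 <= b * (n%:R * B) by rewrite !mulr_ge0.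
apply: (@le_trans _ _ (transition F mu (fun y => a%:E * (EFin \o H) y +
    b%:E * (EFin \o S) y + (b * (n%:R * B))%:E)%E x)).
  apply: le_transition => //.
  - exact: measurable_iter_transition.
  - by apply: emeasurable_funD => //; apply: emeasurable_funD => //;
      exact: measurable_funeM.
  - exact: iter_transition_ge0.
  - by move=> y; rewrite (le_trans (IH y))// /= -!EFinM -!EFinD lee_fin mulrDr addrA.
rewrite transition_affine//.
apply: (@le_trans _ _ (a%:E * ((1 - eps) * H x + delta * S x)%:E +
    b%:E * (S x + B)%:E + (b * (n%:R * B))%:E)%E).
  by apply: leeD => //; apply: leeD; apply: lee_wpmul2l; rewrite ?lee_fin.
rewrite -!EFinM -!EFinD lee_fin exprS -/a.
have h : a * (delta * S x) <= delta * S x by rewrite ler_piMl// mulr_ge0.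
rewrite -subr_ge0 -natr1 [leRHS](_ : _ =
    (delta * S x - a * (delta * S x)) + delta * (n%:R + 1) * B).
  by rewrite addr_ge0 ?subr_ge0// !mulr_ge0// addr_ge0.
by rewrite /b; ring.
Qed.

End geometric_drift_with_error.

Section synchronous_coupling.
Context {R : realType} {p : nat} (mu : probability 'rV[R]_p R).
Variable g : 'rV[R]_p -> 'rV[R]_p.
Implicit Types x y z : 'rV[R]_p.

Definition ar_map (xz : 'rV[R]_p * 'rV[R]_p) : 'rV[R]_p := g xz.1 + xz.2.

(** One step of two copies of the chain driven by the same innovation. *)
Definition sync_map (xyz : ('rV[R]_p * 'rV[R]_p) * 'rV[R]_p)
    : 'rV[R]_p * 'rV[R]_p :=
  (ar_map (xyz.1.1, xyz.2), ar_map (xyz.1.2, xyz.2)).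

Lemma backward_sync (Omega : Type) (Z : nat -> Omega -> 'rV[R]_p) n w x y :
  backward sync_map Z n w (x, y) =
  (backward ar_map Z n w x, backward ar_map Z n w y).
Proof. by elim: n x y => [//|n IH] x y /=; rewrite IH. Qed.

Hypothesis g_nonexp : forall x y, enorm (g x - g y) <= enorm (x - y).

Lemma measurable_ar_map : measurable_fun setT ar_map.
Proof.
apply: measurable_rVD; last exact: measurable_snd.
apply: (measurableT_comp (nonexpansive_measurable g_nonexp)).
exact: measurable_fst.
Qed.

Lemma measurable_sync_map : measurable_fun setT sync_map.
Proof.
apply: measurable_fun_pair.
  apply: (measurableT_comp measurable_ar_map (g := fun xyz => (xyz.1.1, xyz.2))).
  apply: measurable_fun_pair; last exact: measurable_snd.
  by apply: (measurableT_comp measurable_fst); exact: measurable_fst.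
apply: (measurableT_comp measurable_ar_map (g := fun xyz => (xyz.1.2, xyz.2))).
apply: measurable_fun_pair; last exact: measurable_snd.
by apply: (measurableT_comp measurable_snd); exact: measurable_fst.
Qed.

Lemma measurable_edist :
  measurable_fun setT (fun xy : 'rV[R]_p * 'rV[R]_p => enorm (xy.1 - xy.2)).
Proof.
apply: (measurableT_comp measurable_enorm); apply: measurable_rVB.
  exact: measurable_fst.
exact: measurable_snd.
Qed.

(** The innovation cancels in the difference of the two copies, so their
    distance leaves the integral. *)
Lemma transition_sync_separable (V : 'rV[R]_p -> R) K x y a a' :
  measurable_fun setT V -> (forall x, 0 <= V x) -> 0 <= K ->
  (\int[mu]_z (V (g x + z))%:E <= a%:E)%E ->
  (\int[mu]_z (V (g y + z))%:E <= a'%:E)%E ->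
  (transition sync_map mu
    (fun xy => (enorm (xy.1 - xy.2) * (V xy.1 + V xy.2 + K))%:E) (x, y)
   <= (enorm (g x - g y) * (a + a' + K))%:E)%E.
Proof.
move=> mV V0 K0 ha ha'; rewrite /transition /=.
have mVg u : measurable_fun setT (fun z => V (g u + z)).
  by apply: (measurableT_comp mV); exact: measurable_rVD.
have mVg' u : measurable_fun setT (fun z => (V (g u + z))%:E).
  exact/measurable_EFinP.
set D := enorm (g x - g y).
have -> : (\int[mu]_z (enorm (g x + z - (g y + z)) * (V (g x + z) + V (g y + z) + K))%:E
   = D%:E * (\int[mu]_z (V (g x + z))%:E + \int[mu]_z (V (g y + z))%:E + K%:E))%E.
  transitivity (\int[mu]_z (D%:E * ((V (g x + z))%:E + (V (g y + z))%:E + K%:E)))%E.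
    apply: eq_integral => z _; rewrite opprD addrACA subrr addr0 -/D.
    by rewrite EFinM !EFinD.
  rewrite ge0_integralZl_EFin//.
  - congr (_ * _)%E; rewrite ge0_integralD//.
    + rewrite integral_cst//= probability_setT mule1; congr (_ + _)%E.
      by rewrite ge0_integralD// => z _; rewrite lee_fin.
    + by move=> z _; rewrite adde_ge0// lee_fin.
    + exact: emeasurable_funD.
  - by move=> z _; rewrite !adde_ge0// lee_fin.
  - by apply: emeasurable_funD => //; exact: emeasurable_funD.
  - exact: enorm_ge0.
rewrite EFinM !EFinD; apply: lee_wpmul2l; first by rewrite lee_fin enorm_ge0.
by rewrite leeD2r// leeD.
Qed.

End synchronous_coupling.

(** * One-step contraction of a coupled pair *)

Section pair_contraction.
Context {R : realType} {p : nat} (mu : probability 'rV[R]_p R).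
Variable g : 'rV[R]_p -> 'rV[R]_p.
Implicit Types x y z : 'rV[R]_p.
Hypothesis g_ball : forall M, 0 < M ->
  exists C, 0 < C < 1 /\ lipschitz_on_ball g M C.

(** Each pair of points lies in some ball. *)
Lemma ball_lipschitz_nonexpansive x y : enorm (g x - g y) <= enorm (x - y).
Proof.
have N0 : 0 < enorm x + enorm y + 1.
  by rewrite ltr_wpDl// addr_ge0// enorm_ge0.
have [C [/andP[C0 C1] gC]] := g_ball N0.
apply: (le_trans (gC x y _ _)).
- by rewrite -addrA lerDl addr_ge0// enorm_ge0.
- by rewrite [_ + enorm y]addrC -addrA lerDl addr_ge0// enorm_ge0.
- by rewrite ler_piMl ?enorm_ge0// ltW.
Qed.

(* V is the Lyapunov function, w the relative speed of its drift as a function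
   of the norm, and L q a lower bound for V outside the ball of radius q. *)
Variables (V : 'rV[R]_p -> R) (L w : R -> R) (C1 c M B : R).
Hypothesis mV : measurable_fun setT V.
Hypothesis V1 : forall x, 1 <= V x.
Hypothesis V_mono : forall x y, enorm x <= enorm y -> V x <= V y.
Hypothesis C1_gt0 : 0 < C1.
Hypothesis V_size : forall x, enorm x <= C1 * V x.
Hypothesis L_gt0 : forall q, 0 < L q.
Hypothesis V_level : forall q x, 1 <= q -> q < enorm x -> L q <= V x.
Hypothesis w_gt0 : forall q, 1 <= q -> 0 < w q.
Hypothesis w_le1 : forall q, 1 <= q -> w q <= 1.
Hypothesis w_anti : forall q t, 1 <= t -> t <= q -> w q <= w t.
Hypothesis M_ge1 : 1 <= M.
Hypothesis B_gt0 : 0 < B.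
Hypothesis c_gt0 : 0 < c.
Hypothesis V_growth : forall x,
  (\int[mu]_z (V (g x + z))%:E <= (V x + B)%:E)%E.
Hypothesis V_drift : forall x, M <= enorm x ->
  (\int[mu]_z (V (g x + z))%:E <= (V x * (1 - c * w (enorm x)))%:E)%E.
Hypothesis drift_beats_B : forall x, M <= enorm x ->
  4 * B <= c * V x * w (enorm x).

Let V_gt0 x : 0 < V x. Proof. exact: lt_le_trans (V1 x). Qed.

Let Vge0 x : 0 <= V x. Proof. exact: ltW. Qed.

(** Contraction in one step, up to an error caused by points beyond the
    radius q. If both points lie in the ball of radius M, the map contracts and
    a large K hides the growth of V. If one lies outside, its drift beats the
    constant B lost by the other; the drift is at least w q as long as both
    norms are at most q. Beyond q, at least one V is larger than L q, so the
    quadratic quantity is at most a cubic one divided by L q. *)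
Lemma pair_step : exists K c1 C : R, [/\ 0 <= K, 0 < c1 <= 1, 0 <= C &
  forall q x y, 1 <= q ->
  (transition (sync_map g) mu
    (fun xy => (enorm (xy.1 - xy.2) * (V xy.1 + V xy.2 + K))%:E) (x, y)
   <= ((1 - c1 * w q) * (enorm (x - y) * (V x + V y + K))
      + C / L q * (V x ^+ 3 + V y ^+ 3))%:E)%E].
Proof.
have M0 : 0 < M by exact: lt_le_trans M_ge1.
have [gam [/andP[gam0 gam1] hgam]] := g_ball M0.
have gam1' : 0 < 1 - gam by rewrite subr_gt0.
pose K := 4 * B / (1 - gam).
have K0 : 0 < K by rewrite divr_gt0// mulr_gt0.
pose c1 := Num.min ((1 - gam) / 2) (c / (4 * (1 + K))).
have c10 : 0 < c1.
  rewrite lt_min; apply/andP; split; apply: divr_gt0 => //.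
  by rewrite mulr_gt0 ?addr_gt0.
have c1g : c1 <= (1 - gam) / 2 by rewrite ge_min lexx.
have c1c : c1 * (1 + K) <= c / 4.
  rewrite -ler_pdivlMr ?addr_gt0// -mulrA -invfM.
  by rewrite /c1 ge_min lexx orbT.
have [B0' K0' C1'] : [/\ 0 <= B, 0 <= K & 0 <= C1] by rewrite !ltW.
have BK0 : 0 <= 1 + 2 * B + K by rewrite !addr_ge0// mulr_ge0.
exists K, c1, (4 * C1 * (1 + 2 * B + K)); split => //.
- by rewrite c10/=; lra.
- by rewrite !mulr_ge0.
move=> q x y q1.
have q0 : 0 < q by exact: lt_le_trans q1.
have qs0 := w_gt0 q1; have qs1 := w_le1 q1.
set S := V x + V y.
have S1 : 1 <= S by have := V1 x; have := V1 y; rewrite /S; lra.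
have S0 : 0 <= S by lra.
set D := enorm (x - y); have D0 : 0 <= D by exact: enorm_ge0.
set H := D * (S + K).
have H0 : 0 <= H by rewrite mulr_ge0// addr_ge0// ltW.
set eps := c1 * _.
set err := _ * (V x ^+ 3 + V y ^+ 3).
have V30 u : 0 <= V u ^+ 3 by rewrite exprn_ge0.
have err0 : 0 <= err.
  apply: mulr_ge0; last exact: addr_ge0.
  by apply: divr_ge0; [rewrite !mulr_ge0|exact: ltW].
have BK0' : 0 <= 2 * B + K by rewrite addr_ge0// mulr_ge0.
have SBK0 : 0 <= S + 2 * B + K by rewrite -addrA addr_ge0.
have eps0 : 0 < eps by rewrite mulr_gt0.
have eps1 : eps <= (1 - gam) / 2.
  by rewrite (le_trans _ c1g)// /eps ler_piMr// ltW.
have one_eps : 0 <= 1 - eps by lra.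
have gD : enorm (g x - g y) <= D by exact: ball_lipschitz_nonexpansive.
have step := transition_sync_separable (mu := mu) (g := g) mV Vge0 (ltW K0).
have [out|] := boolP ((q < enorm x) || (q < enorm y)).
  (* The norm is itself at most C1 * V, so the whole product is of order S ^+ 2,
     and S ^+ 2 <= S ^+ 3 / L q. *)
  apply: (le_trans (step x y _ _ (V_growth x) (V_growth y))).
  rewrite lee_fin (_ : V x + B + (V y + B) + K = S + 2 * B + K); last first.
    by rewrite /S; ring.
  apply: (@le_trans _ _ err); last first.
    by rewrite lerDr mulr_ge0.
  have DS : D <= C1 * S.
    rewrite /D (le_trans (enorm_triangle _ _))// enormN /S mulrDr.
    by rewrite lerD.
  have SB : S + 2 * B + K <= (1 + 2 * B + K) * S.
    have h : 0 <= (2 * B + K) * (S - 1).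
      by rewrite mulr_ge0 ?subr_ge0.
    by rewrite -subr_ge0; apply: (le_trans h); rewrite le_eqVlt;
      apply/orP; left; apply/eqP; ring.
  have LS : L q <= S.
    case/orP: out => /(V_level q1) h; rewrite (le_trans h)// /S ?lerDl ?lerDr.
      exact: Vge0.
    exact: Vge0.
  have S3 : S ^+ 3 <= 4 * (V x ^+ 3 + V y ^+ 3).
    rewrite /S; set u := V x; set v := V y.
    have h : 0 <= 3 * (u + v) * (u - v) ^+ 2.
      by rewrite mulr_ge0 ?sqr_ge0// mulr_ge0// addr_ge0.
    by rewrite -subr_ge0; apply: (le_trans h); rewrite le_eqVlt;
      apply/orP; left; apply/eqP; ring.
  apply: (@le_trans _ _ (C1 * S * ((1 + 2 * B + K) * S))).
    apply: ler_pM => //.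
    - exact: enorm_ge0.
    - exact: le_trans DS.
  have -> : C1 * S * ((1 + 2 * B + K) * S) = C1 * (1 + 2 * B + K) * S ^+ 2 by ring.
  have -> : err = C1 * (1 + 2 * B + K) *
      ((L q)^-1 * (4 * (V x ^+ 3 + V y ^+ 3))).
    by rewrite /err; ring.
  rewrite ler_pM2l; last by rewrite mulr_gt0// -addrA ltr_pwDl.
  rewrite ler_pdivlMl//.
  apply: le_trans S3; rewrite [S ^+ 3]exprS.
  by rewrite ler_wpM2r ?sqr_ge0.
rewrite negb_or -!leNgt => /andP[xq yq].
have drop_err X : (X <= ((1 - eps) * H)%:E -> X <= ((1 - eps) * H + err)%:E)%E.
  by move=> /le_trans; apply; rewrite lee_fin lerDl.
apply: drop_err.
(* u is the point of larger norm: its V is at least half of the sum, which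
   converts its drift into a drift of the sum. *)
have far u v : M <= enorm u -> enorm u <= q -> enorm v <= enorm u ->
    V u * (1 - c * w (enorm u)) + (V v + B) + K
    <= (1 - eps) * (V u + V v + K).
  move=> Mu uq vu.
  have u0 : 0 < enorm u by exact: lt_le_trans Mu.
  have h1 := drift_beats_B Mu.
  have h2 : w q <= w (enorm u).
    by apply: w_anti => //; exact: le_trans Mu.
  have h3 := V_mono vu.
  have h4 : V u + V v + K <= (1 + K) * (2 * V u).
    have h : 0 <= K * (2 * V u - 1).
      by rewrite mulr_ge0//; have := V1 u; lra.
    by rewrite mulrDl mul1r; lra.
  have h5 : eps * (V u + V v + K) <= c / 2 * V u * w q.
    apply: (@le_trans _ _ (eps * ((1 + K) * (2 * V u)))).
      by rewrite ler_pM2l// mulr_gt0.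
    rewrite (_ : eps * _ = c1 * (1 + K) * (2 * V u * w q)); last first.
      by rewrite /eps; ring.
    rewrite (_ : c / 2 * _ * _ = c / 4 * (2 * V u * w q)); last by field.
    by rewrite ler_pM2r// !mulr_gt0// V_gt0.
  have h6 : c / 2 * V u * w q <= c / 2 * V u * w (enorm u).
    by rewrite ler_pM2l// !mulr_gt0 ?V_gt0// invr_gt0.
  set t := w (enorm u) in h1 h6 *.
  have h7 : 0 <= c * V u * t by rewrite (le_trans _ h1)// mulr_ge0// ltW.
  have -> : V u * (1 - c * t) + (V v + B) + K =
    (V u + V v + K) + (B - c * V u * t) by ring.
  rewrite mulrBl mul1r lerD2l.
  have : c / 2 * V u * t = c * V u * t / 2 by field.
  move: h1 h5 h6 h7; set e1 := c * V u * t; set e2 := eps * _; set e3 := _ * w q.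
  by move=> h1 h5 h6 h7 h8; rewrite h8 in h6; lra.
have [/andP[xM yM]|] := boolP ((enorm x <= M) && (enorm y <= M)).
  (* K was chosen so that K * (1 - gam) = 4 * B, which leaves half of the
     contraction factor. *)
  apply: (le_trans (step x y _ _ (V_growth x) (V_growth y))); rewrite lee_fin.
  rewrite (_ : V x + B + (V y + B) + K = S + 2 * B + K); last by rewrite /S; ring.
  apply: (@le_trans _ _ (gam * D * (S + 2 * B + K))).
    by rewrite ler_wpM2r//; exact: hgam.
  have -> : (1 - eps) * H = D * ((1 - eps) * (S + K)) by rewrite /H; ring.
  rewrite -mulrA mulrCA ler_wpM2l//.
  apply: (@le_trans _ _ ((1 - (1 - gam) / 2) * (S + K))); last first.
    by rewrite ler_wpM2r ?addr_ge0 ?(ltW K0)//; lra.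
  have KE : K * (1 - gam) = 4 * B by rewrite /K divfK// gt_eqF.
  rewrite -subr_ge0 (_ : _ - _ = (1 - gam) / 2 * S + (K * (1 - gam) / 2 - 2 * B * gam));
    last by field.
  rewrite KE addr_ge0 ?mulr_ge0 ?divr_ge0// ?(ltW gam1')//.
  rewrite (_ : _ - _ = 2 * B * (1 - gam)); last by field.
  by rewrite !mulr_ge0// ltW.
rewrite negb_and -!ltNge => Mxy.
have [yx|/ltW xy] := leP (enorm y) (enorm x).
- have Mx : M <= enorm x.
    by case/orP: Mxy => /ltW// h; exact: le_trans h yx.
  apply: (le_trans (step x y _ _ (V_drift Mx) (V_growth y))).
  rewrite lee_fin /H mulrCA; apply: (@le_trans _ _ (enorm (g x - g y) * ((1 - eps) * (S + K)))).
    by rewrite ler_wpM2l ?enorm_ge0//; exact: far.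
  by rewrite ler_wpM2r// mulr_ge0// addr_ge0.
- have My : M <= enorm y.
    by case/orP: Mxy => /ltW// h; exact: le_trans h xy.
  apply: (le_trans (step x y _ _ (V_growth x) (V_drift My))).
  rewrite lee_fin /H mulrCA; apply: (@le_trans _ _ (enorm (g x - g y) * ((1 - eps) * (S + K)))).
    rewrite ler_wpM2l ?enorm_ge0// [V x + B + _]addrC /S [V x + V y]addrC.
    exact: far.
  by rewrite ler_wpM2r// mulr_ge0// addr_ge0.
Qed.

(* The cube of a Lyapunov function exp (b |x| ^ s / 3) is again of this form,
   with its own growth bound. *)
Variable V3 : 'rV[R]_p -> R.
Hypothesis V3E : forall x, V3 x = V x ^+ 3.
Hypothesis V3_growth : exists2 B', 0 <= B' & forall x,
  (\int[mu]_z (V3 (g x + z))%:E <= (V3 x + B')%:E)%E.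

(** The radius q is free: it can be adapted to the number of steps. *)
Lemma pair_iter : exists c1 C B' : R, [/\ 0 < c1 <= 1, 0 < C, 0 <= B' &
  forall q n x y, 1 <= q ->
  (iter n (transition (sync_map g) mu)
    (fun xy => (enorm (xy.1 - xy.2))%:E) (x, y)
   <= ((1 - c1 * w q) ^+ n * (C * (V3 x + V3 y))
      + C / L q * n%:R * (V3 x + V3 y + n%:R * B'))%:E)%E].
Proof.
have [B' B'0] := V3_growth.
have -> : V3 = (fun x => V x ^+ 3) by exact/funext.
move=> hB'; have [K [c1 [C [K0 c11 C0 hstep]]]] := pair_step.
have C10 : 0 <= C1 by exact: ltW.
exists c1, (4 * C1 * (1 + K) + C), (2 * B'); split => //.
- rewrite ltr_pwDl// !mulr_gt0//; lra.
- by rewrite mulr_ge0.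
move=> q n x y q1.
pose H (xy : 'rV[R]_p * 'rV[R]_p) := enorm (xy.1 - xy.2) * (V xy.1 + V xy.2 + K).
pose S (xy : 'rV[R]_p * 'rV[R]_p) := V xy.1 ^+ 3 + V xy.2 ^+ 3.
have mV1 : measurable_fun setT (fun xy : 'rV[R]_p * 'rV[R]_p => V xy.1).
  by apply: (measurableT_comp mV); exact: measurable_fst.
have mV2 : measurable_fun setT (fun xy : 'rV[R]_p * 'rV[R]_p => V xy.2).
  by apply: (measurableT_comp mV); exact: measurable_snd.
have mH : measurable_fun setT H.
  apply: measurable_funM; first exact: measurable_edist.
  by apply: measurable_funD => //; exact: measurable_funD.
have mS : measurable_fun setT S.
  by apply: measurable_funD; exact: measurable_funX.
have H0 xy : 0 <= H xy by rewrite mulr_ge0 ?enorm_ge0// !addr_ge0.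
have V30 u : 0 <= V u ^+ 3 by rewrite exprn_ge0.
have S0 xy : 0 <= S xy by rewrite addr_ge0.
have eps01 : 0 <= c1 * w q <= 1.
  have /andP[c10 c1le] := c11; have w0 := ltW (w_gt0 q1).
  by rewrite mulr_ge0 ?(ltW c10)// mulr_ile1 ?(ltW c10)// w_le1.
have CL0 : 0 <= C / L q by rewrite divr_ge0// ltW.
have mG := measurable_sync_map ball_lipschitz_nonexpansive.
have QS xy : (transition (sync_map g) mu (EFin \o S) xy <= (S xy + 2 * B')%:E)%E.
  have mV3 u : measurable_fun setT (fun z => (V (g u + z) ^+ 3)%:E).
    apply/measurable_EFinP; apply: measurable_funX.
    by apply: (measurableT_comp mV); exact: measurable_rVD.
  rewrite /transition [X in (X <= _)%E](_ : _ =
      (\int[mu]_z (V (g xy.1 + z) ^+ 3)%:E + \int[mu]_z (V (g xy.2 + z) ^+ 3)%:E)%E).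
    apply: (le_trans (leeD (hB' xy.1) (hB' xy.2))).
    by rewrite -EFinD lee_fin /S le_eqVlt; apply/orP; left; apply/eqP; ring.
  by rewrite -ge0_integralD// => z _; rewrite lee_fin.
have QH xy : (transition (sync_map g) mu (EFin \o H) xy <=
    ((1 - c1 * w q) * H xy + C / L q * S xy)%:E)%E.
  by case: xy => u v; exact: hstep.
have B2 : 0 <= 2 * B' by rewrite mulr_ge0.
have := iter_transition_contract mG mH mS H0 S0 eps01 CL0 B2 QH QS n (x, y).
set u := V x; set v := V y.
have Hle : H (x, y) <= (4 * C1 * (1 + K)) * S (x, y).
  rewrite /H /S /= -/u -/v; have u1 : 1 <= u := V1 x; have v1 : 1 <= v := V1 y.
  have uv0 : 0 <= u + v by lra.
  have uv1 : 1 <= u + v by lra.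
  have D : enorm (x - y) <= C1 * (u + v).
    by rewrite (le_trans (enorm_triangle _ _))// enormN mulrDr lerD.
  have uvK : u + v + K <= (1 + K) * (u + v).
    by rewrite mulrDl mul1r lerD2l ler_peMr.
  apply: (@le_trans _ _ (C1 * (u + v) * ((1 + K) * (u + v)))).
    by rewrite ler_pM ?enorm_ge0// addr_ge0.
  have S3 : (u + v) ^+ 2 <= 4 * (u ^+ 3 + v ^+ 3).
    apply: (@le_trans _ _ ((u + v) ^+ 3)).
      by rewrite [leRHS]exprS ler_peMl ?sqr_ge0.
    have h : 0 <= 3 * (u + v) * (u - v) ^+ 2 by rewrite mulr_ge0 ?sqr_ge0// mulr_ge0.
    by rewrite -subr_ge0; apply: (le_trans h); rewrite le_eqVlt;
      apply/orP; left; apply/eqP; ring.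
  rewrite (_ : _ * _ = C1 * (1 + K) * (u + v) ^+ 2); last by ring.
  rewrite (_ : 4 * C1 * _ * _ = C1 * (1 + K) * (4 * (u ^+ 3 + v ^+ 3))); last by ring.
  by rewrite ler_wpM2l// mulr_ge0// addr_ge0.
move=> it; apply: (@le_trans _ _ (iter n (transition (sync_map g) mu) (EFin \o H) (x, y))).
  apply: le_iter_transition => //.
  - by apply/measurable_EFinP; exact: measurable_edist.
  - exact/measurable_EFinP.
  - by move=> xy; rewrite lee_fin enorm_ge0.
  - move=> xy; rewrite lee_fin ler_peMr ?enorm_ge0//.
    by have := V1 xy.1; have := Vge0 xy.2; lra.
apply: (le_trans it); rewrite lee_fin.
have e0 : 0 <= 1 - c1 * w q by rewrite subr_ge0; case/andP: eps01.
have Cle : C / L q <= (4 * C1 * (1 + K) + C) / L q.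
  by rewrite ler_pM2r ?invr_gt0// lerDr !mulr_ge0// addr_ge0.
apply: lerD.
  rewrite ler_wpM2l ?exprn_ge0// (le_trans Hle)// ler_wpM2r//.
  by rewrite lerDl.
rewrite ler_wpM2r//; last by rewrite ler_wpM2r.
by rewrite addr_ge0// mulr_ge0.
Qed.

End pair_contraction.

(** * Stretched exponential contraction *)

Section contraction_rate.
Context {R : realType} {p : nat} (mu : probability 'rV[R]_p R).
Variable g : 'rV[R]_p -> 'rV[R]_p.
Implicit Types x y z : 'rV[R]_p.
Hypothesis g_ball : forall M, 0 < M ->
  exists C, 0 < C < 1 /\ lipschitz_on_ball g M C.
Variables (s rho b c M B B' : R).
Hypothesis s_gt0 : 0 < s.
Hypothesis s_rho : s <= rho.
Hypothesis b_gt0 : 0 < b.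
Hypothesis c_gt0 : 0 < c.
Hypothesis B_gt0 : 0 < B.
Hypothesis B'_gt0 : 0 < B'.

Local Notation V := (lyap s (b / 3)).
Local Notation V3 := (lyap s b).

Hypothesis V_growth : forall x,
  (\int[mu]_z (V (g x + z))%:E <= (V x + B)%:E)%E.
Hypothesis V_drift : forall x, M <= enorm x ->
  (\int[mu]_z (V (g x + z))%:E <= (V x * (1 - c * enorm x `^ (s - rho)))%:E)%E.
Hypothesis V3_growth : forall x,
  (\int[mu]_z (V3 (g x + z))%:E <= (V3 x + B')%:E)%E.

Let rho_gt0 : 0 < rho. Proof. exact: lt_le_trans s_rho. Qed.

Let b3_gt0 : 0 < b / 3. Proof. by rewrite divr_gt0. Qed.

Lemma lyap_cube x : V x ^+ 3 = V3 x.
Proof. by rewrite /lyap -expRM_natl; congr expR; field. Qed.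

Lemma enorm_le_lyap : exists2 C, 0 < C & forall x, enorm x <= C * V x.
Proof.
exists ((s^-1 / (b / 3)) `^ s^-1); first by rewrite powR_gt0// divr_gt0 ?invr_gt0.
move=> x; have := @powR_le_expR _ s^-1 (b / 3) (enorm x `^ s).
rewrite -powRrM mulfV ?gt_eqF// powRr1 ?enorm_ge0//; apply => //.
- by rewrite invr_gt0.
- exact: powR_ge0.
Qed.

(** V is exponential in a power of the norm, the speed of the drift is only
    polynomially small. *)
Lemma drift_beats_constant : exists M3, [/\ 1 <= M3, M <= M3 &
  forall x, M3 <= enorm x -> 4 * B <= c * V x * enorm x `^ (s - rho)].
Proof.
pose C := (rho / s / (b / 6)) `^ (rho / s).
have C0 : 0 < C by rewrite powR_gt0// !divr_gt0.
pose N := (24 * B * C / (c * b)) `^ s^-1.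
exists (Num.max (Num.max 1 M) N); split; rewrite ?le_max ?lexx ?orbT//.
move=> x; rewrite !ge_max => /andP[/andP[t1 _] tN].
set t := enorm x in t1 tN *.
have t0 : 0 < t by exact: lt_le_trans t1.
have tsge : 24 * B * C / (c * b) <= t `^ s.
  have : N `^ s <= t `^ s.
    by apply: ge0_ler_powR; rewrite ?nnegrE ?powR_ge0 ?(ltW t0) ?(ltW s_gt0).
  by rewrite -powRrM mulVf ?gt_eqF// powRr1// ltW// divr_gt0 ?mulr_gt0.
have trho : t `^ rho <= C * expR (b / 6 * t `^ s).
  have := @powR_le_expR _ (rho / s) (b / 6) (t `^ s).
  rewrite -powRrM [s * _]mulrC divfK ?gt_eqF//; apply.
  - by rewrite divr_gt0.
  - by rewrite divr_gt0.
  - exact: powR_ge0.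
have tsr : t `^ (- rho) <= t `^ (s - rho).
  by apply: ler_powR => //; rewrite lerDr ltW.
apply: (@le_trans _ _ (c * V x * t `^ (- rho))); last first.
  by rewrite ler_pM2l// mulr_gt0// expR_gt0.
rewrite powRN ler_pdivlMr ?powR_gt0//.
apply: (@le_trans _ _ (4 * B * (C * expR (b / 6 * t `^ s)))).
  by rewrite ler_pM2l// mulr_gt0.
have -> : V x = expR (b / 6 * t `^ s) * expR (b / 6 * t `^ s).
  by rewrite -expRD /lyap -/t; congr expR; field.
rewrite !mulrA ler_pM2r ?expR_gt0//.
apply: (@le_trans _ _ (c * (b / 6 * t `^ s))); last first.
  by rewrite ler_pM2l// (le_trans _ (expR_ge1Dx _))// lerDr.
have := tsge; rewrite ler_pdivrMr ?mulr_gt0// => h.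
rewrite (_ : c * _ = t `^ s * (c * b) / 6); last by field.
rewrite ler_pdivlMr//; apply: le_trans h; rewrite le_eqVlt; apply/orP; left.
by apply/eqP; ring.
Qed.

(** Both terms of [pair_iter] at the radius n ^ (1 / rho), with
    y = n ^ (s / rho): half of the exponent b / 3 of the error term absorbs the
    polynomial factor n ^ 2. *)
Lemma rate_bound (c1 C D sigma y n S : R) :
  0 < c1 -> 0 < C -> 0 <= D -> 0 < sigma -> 1 <= n -> 1 <= S ->
  y = n `^ sigma ->
  expR (- c1 * y) * (C * S) + C / expR (b / 3 * y) * n * (S + n * D) <=
  (C + C * (1 + D) * (2 / sigma / (b / 6)) `^ (2 / sigma)) * S *
    expR (- Num.min c1 (b / 6) * y).
Proof.
move=> c10 C0 D0 sig0 n1 S1 yE.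
have n0 : 0 <= n by exact: le_trans n1.
have y0 : 0 <= y by rewrite yE powR_ge0.
have b6 : 0 < b / 6 by rewrite divr_gt0.
set P := (_ / _) `^ _.
have nP : n ^+ 2 <= P * expR (b / 6 * y).
  have := powR_le_expR (divr_gt0 (ltr0Sn R 1) sig0) b6 y0.
  by rewrite {1}yE -powRrM [sigma * _]mulrC divfK ?gt_eqF// powR_mulrn.
have Pge0 : 0 <= P by exact: powR_ge0.
set e := expR (- Num.min c1 (b / 6) * y).
have e1 : expR (- c1 * y) <= e.
  by rewrite ler_expR ler_wpM2r// lerN2 ge_min lexx.
have e2 : expR (b / 6 * y) / expR (b / 3 * y) <= e.
  rewrite -expRB ler_expR (_ : b / 6 * y - b / 3 * y = - (b / 6) * y); last by field.
  by rewrite ler_wpM2r// lerN2 ge_min lexx orbT.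
have S0 : 0 <= S by exact: le_trans S1.
have SD : S + n * D <= n * (1 + D) * S.
  have h : 0 <= S * (n - 1) + n * D * (S - 1).
    by rewrite addr_ge0// !mulr_ge0// subr_ge0.
  by rewrite -subr_ge0; apply: (le_trans h); rewrite le_eqVlt;
    apply/orP; left; apply/eqP; ring.
have CS0 : 0 <= C * S by rewrite mulr_ge0// ltW.
rewrite !mulrDl; apply: lerD; first by rewrite mulrC ler_wpM2l.
have L0 : 0 < expR (b / 3 * y) by exact: expR_gt0.
apply: (@le_trans _ _ (C / expR (b / 3 * y) * n * (n * (1 + D) * S))).
  by rewrite ler_wpM2l// mulr_ge0// divr_ge0// ltW.
have CD0 : 0 <= C * (1 + D) * S by rewrite mulr_ge0// mulr_ge0 ?addr_ge0// ltW.
rewrite (_ : _ * (n * _ * S) = C * (1 + D) * S * (n ^+ 2 / expR (b / 3 * y)));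
  last by ring.
rewrite (_ : C * (1 + D) * P * S * e = C * (1 + D) * S * (P * e)); last by ring.
rewrite ler_wpM2l//.
apply: (@le_trans _ _ (P * expR (b / 6 * y) / expR (b / 3 * y))).
  by rewrite ler_wpM2r// invr_ge0 ltW.
by rewrite -mulrA ler_wpM2l.
Qed.

Let V_mono x y : enorm x <= enorm y -> V x <= V y.
Proof.
move=> xy; rewrite ler_expR ler_pM2l//.
by apply: ge0_ler_powR; rewrite ?nnegrE ?enorm_ge0// ltW.
Qed.

Let V_level q x : 1 <= q -> q < enorm x -> expR (b / 3 * q `^ s) <= V x.
Proof.
move=> q1 qx; rewrite ler_expR ler_pM2l//.
have q0 : 0 <= q by exact: le_trans q1.
by apply: ge0_ler_powR; rewrite ?nnegrE ?enorm_ge0//; exact: ltW.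
Qed.

Let V3S x y : 1 <= V3 x + V3 y.
Proof.
rewrite -[leLHS]addr0; apply: lerD; last exact: expR_ge0.
by apply: lyap_ge1; exact: ltW.
Qed.

#[local] Opaque lyap.

(** With the radius q = n ^ (1 / rho) the accumulated drift
    n q ^ (s - rho) and the exponent q ^ s of the truncation error are the same
    power n ^ (s / rho). *)
Theorem sync_contraction : exists C c0 : R, [/\ 0 < C, 0 < c0 &
  forall n x y, (iter n (transition (sync_map g) mu)
    (fun xy => (enorm (xy.1 - xy.2))%:E) (x, y)
   <= (C * (V3 x + V3 y) * expR (- c0 * n%:R `^ (s / rho)))%:E)%E].
Proof.
have [M3 [M31 MM3 hM3]] := drift_beats_constant.
have [C1 C10 hC1] := enorm_le_lyap.
have sig0 : 0 < s / rho by rewrite divr_gt0.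
have := @pair_iter _ p mu g g_ball V (fun q => expR (b / 3 * q `^ s))
  (fun q => q `^ (s - rho)) C1 c M3 B _ _ _ _ _ _ _ _ _ _ _ _ _ _ _ _ V3.
case.
- exact: measurable_expR_enorm.
- by move=> x; apply: lyap_ge1; exact: ltW.
- exact: V_mono.
- by [].
- exact: hC1.
- by move=> q; exact: expR_gt0.
- exact: V_level.
- by move=> q q1; apply: powR_gt0; exact: lt_le_trans q1.
- by move=> q q1; rewrite -(powRr0 q) ler_powR// subr_le0.
- move=> q t t1 tq; have t0 : 0 < t by exact: lt_le_trans t1.
  have q0 : 0 < q by exact: lt_le_trans tq.
  rewrite -(opprB rho s) !powRN lef_pV2 ?posrE ?powR_gt0//.
  by apply: ge0_ler_powR; rewrite ?nnegrE ?subr_ge0 ?(ltW t0) ?(ltW q0).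
- exact: M31.
- exact: B_gt0.
- exact: c_gt0.
- exact: V_growth.
- by move=> x /(le_trans MM3); exact: V_drift.
- exact: hM3.
- by move=> x; rewrite -lyap_cube.
- by exists B'; first exact: ltW.
move=> c1 [C [D [/andP[c10 c11] C0 D0 hiter]]].
exists (C + C * (1 + D) * (2 / (s / rho) / (b / 6)) `^ (2 / (s / rho))),
  (Num.min c1 (b / 6)); split.
- by rewrite ltr_pwDl// mulr_ge0 ?powR_ge0// mulr_ge0 ?addr_ge0// ltW.
- by rewrite lt_min c10 divr_gt0.
move=> n x y; case: n => [|n].
  have := hiter 1 0%N x y (lexx _) => /le_trans; apply.
  rewrite lee_fin expr0 mul1r mulr0 mul0r addr0.
  rewrite powR0 ?gt_eqF// mulr0 expR0 mulr1 ler_wpM2r//.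
    by rewrite (le_trans ler01).
  by rewrite lerDl mulr_ge0 ?powR_ge0// mulr_ge0 ?addr_ge0// ltW.
set N : R := n.+1%:R.
have N1 : 1 <= N by rewrite /N ler1n.
have N0 : 0 < N by exact: lt_le_trans N1.
(* This radius makes N * q ^ (s - rho) equal to q ^ s. *)
pose q := N `^ rho^-1.
have q1 : 1 <= q by rewrite -(powRr0 N) ler_powR// invr_ge0 ltW.
have := hiter q n.+1 x y q1 => /le_trans; apply; rewrite lee_fin.
have qs : q `^ s = N `^ (s / rho) by rewrite -powRrM mulrC.
have qN : N * q `^ (s - rho) = N `^ (s / rho).
  rewrite -powRrM -[X in X * _](powRr1 (ltW N0)) -powRD ?(gt_eqF N0) ?implybT//.
  by congr (_ `^ _); field; rewrite gt_eqF.
rewrite qs -/N.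
apply: le_trans (rate_bound c10 C0 D0 sig0 N1 (V3S x y) (erefl _)).
rewrite lerD2r ler_wpM2r//.
  by rewrite mulr_ge0// ?(ltW C0)// (le_trans ler01).
have w0 : 0 <= c1 * q `^ (s - rho) by rewrite mulr_ge0 ?powR_ge0// ltW.
have w1 : c1 * q `^ (s - rho) <= 1.
  rewrite mulr_ile1 ?powR_ge0 ?(ltW c10)//.
  by rewrite -(powRr0 q) ler_powR// subr_le0.
apply: (@le_trans _ _ (expR (- (c1 * q `^ (s - rho))) ^+ n.+1)).
  by rewrite lerXn2r ?nnegrE ?subr_ge0 ?expR_ge0// expR_ge1Dx.
rewrite -expRM_natl ler_expR -/N -qN le_eqVlt; apply/orP; left; apply/eqP; ring.
Qed.

End contraction_rate.

(** * Limits of sequences with summable increments *)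

Section limits_in_rV.
Context {R : realType} {p : nat}.

(** Coordinatewise upper limits always exist and depend measurably on a
    parameter; [fine] sends an infinite one to 0. *)
Definition coord_limit (u : nat -> 'rV[R]_p) : 'rV[R]_p :=
  \row_i fine (limn_esup (fun n => (u n 0 i)%:E)).

(** A sequence with summable increments is Cauchy, and the remaining increments
    bound its distance to the limit. *)
Lemma enorm_coord_limit (u : nat -> 'rV[R]_p) :
  (\sum_(0 <= m <oo) (enorm (u m - u m.+1))%:E < +oo)%E ->
  forall n, ((enorm (u n - coord_limit u))%:E <=
    \sum_(0 <= m <oo) (enorm (u (m + n)%N - u (m + n).+1))%:E)%E.
Proof.
move=> Soo n; set l := coord_limit u.
have pos k : (0 <= (enorm (u k - u k.+1))%:E)%E by rewrite lee_fin enorm_ge0.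
have cvgu i : (fun n => u n 0 i) @ \oo --> l 0 i.
  have cu : cvgn (fun n => u n 0 i).
    pose v n := u n 0 i.
    have -> : (fun n => u n 0 i) = (fun n => v 0%N + series (telescope v) n).
      by apply/funext => k; rewrite -eq_sum_telescope.
    apply: is_cvgD; first exact: is_cvg_cst.
    apply: normed_cvg; apply: nondecreasing_is_cvgn.
      by apply/nondecreasing_seqP => k; rewrite /normed_series_of/= seriesSr lerDl.
    exists (fine (\sum_(0 <= m <oo) (enorm (u m - u m.+1))%:E)) => _ [k _ <-].
    have Sf : (\sum_(0 <= m <oo) (enorm (u m - u m.+1))%:E)%E \is a fin_num.
      by rewrite ge0_fin_numE// nneseries_ge0.
    rewrite -lee_fin fineK// (le_trans _ (nneseries_lim_ge k (fun m _ _ => pos m)))//.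
    rewrite sumEFin lee_fin /series/=; apply: ler_sum => m _.
    by rewrite distrC (le_trans _ (coord_le_enorm _ i))// !mxE.
  have -> : l 0 i = limn (fun n => u n 0 i); last exact: cu.
  have cE : (fun n => (u n 0 i)%:E) @ \oo --> (limn (fun n => u n 0 i))%:E.
    by apply: cvg_EFin => //; exact: nearW.
  by rewrite /l mxE (cvg_limn_einf_sup cE).2.
apply/lee_addgt0Pr => e e0.
have p1 : 0 < p.+1%:R :> R by rewrite ltr0n.
have e1 : 0 < e / p.+1%:R by rewrite divr_gt0.
have : \forall N \near \oo, forall i, `|l 0 i - u N 0 i| < e / p.+1%:R.
  by apply: filter_forall => i; move/cvgrPdist_lt : (cvgu i); exact.
move=> [N0 _ hN0]; pose N := maxn n N0.
have hN : enorm (u N - l) <= e.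
  apply: (@le_trans _ _ (p%:R * (e / p.+1%:R))).
    apply: enorm_le_sup => [|i]; first exact: ltW.
    by rewrite !mxE distrC ltW//; have := hN0 N (leq_maxr _ _) i; rewrite mxE.
  by rewrite mulrCA ger_pMr// ler_pdivrMr// mul1r ler_nat.
have tele k : (n <= k)%N -> enorm (u n - u k) <= \sum_(n <= m < k) enorm (u m - u m.+1).
  elim: k => [|k IH]; first by rewrite leqn0 => /eqP ->; rewrite subrr enorm0 big_geq.
  rewrite leq_eqVlt => /predU1P[<-|nk]; first by rewrite subrr enorm0 big_geq.
  rewrite big_nat_recr//= (le_trans (enorm_triangleB _ (u k) _))// lerD2r.
  exact: IH.
apply: (@le_trans _ _ ((enorm (u n - u N))%:E + (enorm (u N - l))%:E)%E).
  by rewrite -EFinD lee_fin enorm_triangleB.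
apply: leeD; last by rewrite lee_fin.
apply: le_trans (nneseries_lim_ge (N - n)%N (fun m _ _ => pos (m + n)%N)).
rewrite sumEFin lee_fin -(big_addn 0 N n predT (fun m => enorm (u m - u m.+1))).
by rewrite add0n; apply: tele; exact: leq_maxl.
Qed.

End limits_in_rV.

Section L1_limit.
Context {R : realType} {p : nat} d (Omega : measurableType d).
Variable Pr : probability Omega R.
Variables (f : nat -> Omega -> 'rV[R]_p) (r t : nat -> R).
Hypothesis mf : forall n, measurable_fun setT (f n).
Hypothesis hr : forall n, (\int[Pr]_w (enorm (f n w - f n.+1 w))%:E <= (r n)%:E)%E.
Hypothesis ht : forall n N, \sum_(n <= m < N) r m <= t n.

Let X w := coord_limit (f ^~ w).

Lemma measurable_coord_limit : measurable_fun setT X.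
Proof.
apply: measurable_fun_rV => i; under eq_fun do rewrite mxE.
apply: (measurableT_comp (fine_measurable _)) => //.
apply: measurable_fun_limn_esup => n; apply/measurable_EFinP.
exact: (measurableT_comp (measurable_coord i)).
Qed.

(** The sum of all increments has a finite expectation, hence is almost surely
    finite. *)
Lemma L1_coord_limit n : (\int[Pr]_w (enorm (f n w - X w))%:E <= (t n)%:E)%E.
Proof.
pose D m w := (enorm (f m w - f m.+1 w))%:E.
have mD m : measurable_fun setT (D m).
  apply/measurable_EFinP; apply: (measurableT_comp measurable_enorm).
  exact: measurable_rVB.
have D0 m w : (0 <= D m w)%E by rewrite lee_fin enorm_ge0.
have tail k : (\int[Pr]_w \sum_(0 <= m <oo) D (m + k)%N w <= (t k)%:E)%E.
  rewrite integral_nneseries//.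
  apply: lime_le; first by apply: is_cvg_nneseries => m _ _; exact: integral_ge0.
  apply: nearW => N; apply: (@le_trans _ _ (\sum_(0 <= m < N) (r (m + k)%N)%:E)%E).
    by apply: lee_sum => m _; exact: hr.
  rewrite sumEFin lee_fin; apply: le_trans (ht k (N + k)%N).
  by rewrite -{2}[k]add0n big_addn addnK.
have int0 : Pr.-integrable setT (fun w => \sum_(0 <= m <oo) D m w)%E.
  apply/integrableP; split.
    by apply: ge0_emeasurable_sum => // m w _ _.
  under eq_integral do rewrite gee0_abs ?nneseries_ge0//.
  apply: le_lt_trans (ltry (t 0%N)); apply: le_trans (tail 0%N).
  rewrite le_eqVlt; apply/orP; left; apply/eqP; apply: eq_integral => w _.
  by apply: eq_eseriesr => m _; rewrite addn0.
have := integrable_ae measurableT int0.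
move=> aefin; apply: le_trans (tail n).
apply: ae_ge0_le_integral => //.
- by move=> w _; rewrite lee_fin enorm_ge0.
- apply/measurable_EFinP; apply: (measurableT_comp measurable_enorm).
  by apply: measurable_rVB => //; exact: measurable_coord_limit.
- by move=> w _; apply: nneseries_ge0.
- by apply: ge0_emeasurable_sum => // m w _ _.
apply: filterS aefin => w /(_ I) fin _.
apply: (enorm_coord_limit (u := f^~ w)).
by move: fin; rewrite ge0_fin_numE//; exact: nneseries_ge0.
Qed.

End L1_limit.

(** * Lipschitz test functions *)

Section lipschitz_determining.
Context {R : realType} {p : nat}.
Implicit Types (A U : set 'rV[R]_p) (x y : 'rV[R]_p).

Definition edist_set A x : R := inf [set enorm (x - y) | y in A].

Let has_lb A x : has_lbound [set enorm (x - y) | y in A].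
Proof. by exists 0 => _ [y _ <-]; exact: enorm_ge0. Qed.

Lemma edist_set_ge0 A x : 0 <= edist_set A x.
Proof.
have [->|/set0P[a Aa]] := eqVneq A set0.
  by rewrite /edist_set image_set0 inf0.
apply: lb_le_inf; first by exists (enorm (x - a)), a.
by move=> _ [y _ <-]; exact: enorm_ge0.
Qed.

Lemma edist_set_le A x y : A y -> edist_set A x <= enorm (x - y).
Proof. by move=> Ay; apply: ge_inf => //; exists y. Qed.

Lemma edist_set_lerD A x y : A !=set0 ->
  edist_set A x <= edist_set A y + enorm (x - y).
Proof.
move=> [a Aa]; rewrite -lerBlDr; apply: lb_le_inf; first by exists (enorm (y - a)), a.
move=> _ [b Ab <-]; rewrite lerBlDr addrC (le_trans (edist_set_le x Ab))//.
exact: enorm_triangleB.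
Qed.

Lemma edist_set_lipschitz A : A !=set0 -> elipschitz 1 (edist_set A).
Proof.
move=> A0 x y; rewrite mul1r ler_norml; apply/andP; split.
  by rewrite lerBrDr addrC lerBlDr enormC; exact: edist_set_lerD.
by rewrite lerBlDl addrC addrC; exact: edist_set_lerD.
Qed.

Lemma edist_setC_gt0 U x : open U -> U x -> 0 < edist_set (~` U) x \/ ~` U = set0.
Proof.
move=> oU Ux; have [->|/set0P[a Ua]] := eqVneq (~` U) set0; [by right|left].
have /nbhs_ballP[e /= e0 xeU] : nbhs x U by exact: open_nbhs_nbhs.
apply: (lt_le_trans e0); apply: lb_le_inf; first by exists (enorm (x - a)), a.
move=> _ [y Uy <-]; rewrite leNgt; apply/negP => xy; apply: Uy; apply: xeU.
exact: enorm_ball.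
Qed.

(** Lipschitz functions that increase to the indicator of an open set. *)
Definition lip_indic U (k : nat) x : R := Num.min 1 (k%:R * edist_set (~` U) x).

Lemma lip_indic_lipschitz U k : ~` U !=set0 -> elipschitz k%:R (lip_indic U k).
Proof.
move=> U0 x y; rewrite /lip_indic.
have : `|k%:R * edist_set (~` U) x - k%:R * edist_set (~` U) y| <= k%:R * enorm (x - y).
  rewrite -mulrBr normrM ger0_norm// ler_wpM2l//.
  by have := edist_set_lipschitz U0 x y; rewrite mul1r.
set a := k%:R * _; set b := k%:R * edist_set _ y; set c := _ * _.
rewrite ler_norml => /andP[h1 h2].
rewrite ler_norml; apply/andP; rewrite !minEle.
by case: (leP 1 a) => ha; case: (leP 1 b) => hb; split; lra.
Qed.

Lemma lip_indic01 U k x : 0 <= lip_indic U k x <= 1.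
Proof.
rewrite /lip_indic ge_min lexx andbT le_min ler01/= mulr_ge0//.
exact: edist_set_ge0.
Qed.

Lemma lip_indic_cvg U x : open U -> ~` U !=set0 ->
  limn (fun k => (lip_indic U k x)%:E) = (\1_U x)%:E.
Proof.
move=> oU U0; apply: lim_near_cst => //; rewrite indicE.
have [Ux|Ux] := pselect (U x).
  have [d0|/seteqP[U00 _]] := edist_setC_gt0 oU Ux; last first.
    by case: U0 => z /U00.
  rewrite mem_set//=; set dd := edist_set _ _ in d0.
  exists (Num.truncn dd^-1).+1 => // k /= hk; congr (_%:E).
  apply/min_idPl; rewrite -ler_pdivrMr// mul1r.
  rewrite ltW//; apply: (lt_le_trans (truncnS_gt _)); rewrite ler_nat//.
rewrite memNset//=; apply: nearW => k; congr (_%:E).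
rewrite /lip_indic; have -> : edist_set (~` U) x = 0.
  apply/eqP; rewrite eq_le edist_set_ge0 andbT.
  by have := @edist_set_le (~` U) x x Ux; rewrite subrr enorm0.
by rewrite mulr0; apply/min_idPr.
Qed.

(** By monotone convergence the two measures agree on open sets, a pi-system
    that generates the Borel sets. The whole space is treated apart because the
    distance to the empty set is meaningless. *)
Lemma lipschitz_determining (m1 m2 : probability 'rV[R]_p R) :
  (forall K h, 0 <= K -> elipschitz K h -> (forall x, 0 <= h x <= 1) ->
    (\int[m1]_x (h x)%:E = \int[m2]_x (h x)%:E)%E) ->
  forall A, measurable A -> m1 A = m2 A.
Proof.
move=> h12 A mA; apply: (measure_unique (@open 'rV[R]_p) (fun=> setT)) => //.
- by move=> U W; exact: openI.
- by move=> _; exact: openT.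
- by rewrite bigcup_const//; exists 0%N.
- move=> U oU; have [U0|/set0P U0] := eqVneq (~` U) set0.
    by rewrite -[U]setCK U0 setC0 [LHS]probability_setT [RHS]probability_setT.
  have mU : measurable U by exact: sub_sigma_algebra.
  have E (m : probability 'rV[R]_p R) :
      m U = limn (fun k => \int[m]_x (lip_indic U k x)%:E)%E.
    have -> : m U = (\int[m]_x (\1_U x)%:E)%E by rewrite integral_indic// setIT.
    rewrite -monotone_convergence//.
    - by apply: eq_integral => x _; exact/esym/lip_indic_cvg.
    - move=> k; apply/measurable_EFinP.
      exact: elipschitz_measurable (lip_indic_lipschitz _ U0).
    - by move=> k x _; rewrite lee_fin; have /andP[] := lip_indic01 U k x.
    - move=> x _ k l kl; rewrite lee_fin /lip_indic.
      by apply: le_min2; rewrite // ler_wpM2r ?edist_set_ge0// ler_nat.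
  apply: (etrans (E m1)); apply: (etrans _ (esym (E m2))).
  congr (limn _); apply/funext => k.
  apply: (h12 k%:R) => //; first exact: lip_indic_lipschitz.
  exact: lip_indic01.
- by move=> _; rewrite [X in (X < _)%E]probability_setT ltry.
Qed.

End lipschitz_determining.

(** * The autoregressive kernel and its invariant laws *)

Section integral_of_sum_bound.
Context d (T : measurableType d) {R : realType} (P : probability T R).
Local Open Scope ereal_scope.

Lemma le_integral_affine (f h u : T -> R) (k c : R) :
  measurable_fun setT f -> measurable_fun setT h -> measurable_fun setT u ->
  (forall x, 0 <= f x)%R -> (forall x, 0 <= h x)%R -> (forall x, 0 <= u x)%R ->
  (0 <= k)%R -> (0 <= c)%R -> (forall x, f x <= h x + k * u x + c)%R ->
  \int[P]_x (f x)%:E <= \int[P]_x (h x)%:E + k%:E * \int[P]_x (u x)%:E + c%:E.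
Proof.
move=> mf mh mu f0 h0 u0 k0 c0 fhu.
have mh' : measurable_fun setT (fun x => (h x)%:E) by exact/measurable_EFinP.
have mu' : measurable_fun setT (fun x => (u x)%:E) by exact/measurable_EFinP.
have -> : \int[P]_x (h x)%:E + k%:E * \int[P]_x (u x)%:E + c%:E =
    \int[P]_x ((h x)%:E + k%:E * (u x)%:E + c%:E).
  rewrite ge0_integralD//.
  - rewrite integral_cst//= probability_setT mule1; congr (_ + _).
    rewrite ge0_integralD//.
    + by congr (_ + _); rewrite ge0_integralZl_EFin// => x _; rewrite lee_fin.
    + by move=> x _; rewrite lee_fin.
    + by move=> x _; rewrite mule_ge0// lee_fin.
    + exact: measurable_funeM.
  - by move=> x _; rewrite adde_ge0 ?mule_ge0// lee_fin.
  - by apply: emeasurable_funD => //; exact: measurable_funeM.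
apply: ge0_le_integral => //.
- by move=> x _; rewrite lee_fin.
- exact/measurable_EFinP.
- apply: emeasurable_funD => //; apply: emeasurable_funD => //.
  exact: measurable_funeM.
- by move=> x _; rewrite lee_fin; exact: fhu.
Qed.

End integral_of_sum_bound.

Section autoregressive_kernel.
Context {R : realType} {p : nat} (mu : probability 'rV[R]_p R).
Variable g : 'rV[R]_p -> 'rV[R]_p.
Hypothesis g_nonexp : forall x y, enorm (g x - g y) <= enorm (x - y).
Local Open Scope ereal_scope.

Let mgz x : measurable_fun setT (fun z : 'rV[R]_p => g x + z)%R.
Proof. exact: measurable_rVD. Qed.

Lemma ar_kernelE x A : measurable A -> ar_kernel g mu x A = law mu (mgz x) A.
Proof.
move=> mA; rewrite lawE /ar_kernel.
have mpre : measurable ((fun z => g x + z)%R @^-1` A).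
  by rewrite -[X in measurable X]setTI; exact: mgz.
by rewrite -(setIT ((fun z => g x + z)%R @^-1` A)) -integral_indic.
Qed.

(** On non-measurable sets [ar_kernel] differs from the image of [mu]; the
    integral depends only on the values on measurable sets. *)
Lemma integral_ar_kernel x (f : 'rV[R]_p -> \bar R) :
  measurable_fun setT f -> (forall y, 0 <= f y) ->
  \int[ar_kernel g mu x]_y f y = transition (ar_map g) mu f x.
Proof.
move=> mf f0.
have k0 : ar_kernel g mu x set0 = 0 by rewrite ar_kernelE// measure0.
have kge0 A : 0 <= ar_kernel g mu x A.
  by apply: integral_ge0 => z _; rewrite lee_fin.
have kadd : semi_sigma_additive (ar_kernel g mu x).
  move=> F mF tF mUF; rewrite ar_kernelE//.
  under eq_fun do under eq_bigr do rewrite ar_kernelE//.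
  exact: measure_semi_sigma_additive.
pose k : {measure set _ -> \bar R} := HB.pack (ar_kernel g mu x)
  (isMeasure.Build _ _ _ (ar_kernel g mu x) k0 kge0 kadd).
transitivity (\int[law mu (mgz x)]_y f y); last by rewrite ge0_integral_law.
by apply: (@eq_measure_integral _ _ _ _ (law mu (mgz x)) k) => A mA _; exact: ar_kernelE.
Qed.

Lemma kernel_iterE n x A : measurable A ->
  kernel_iter (ar_kernel g mu) n x A =
  iter n (transition (ar_map g) mu) (fun y => (\1_A y)%:E) x.
Proof.
move=> mA; elim: n x => [//|n IH] x /=.
have -> : (fun y => kernel_iter (ar_kernel g mu) n y A) =
    iter n (transition (ar_map g) mu) (fun y => (\1_A y)%:E).
  exact/funext.
apply: integral_ar_kernel.
- apply: measurable_iter_transition; first exact: measurable_ar_map.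
    by apply/measurable_EFinP; exact: measurable_indic.
  by move=> y; rewrite lee_fin.
- by apply: iter_transition_ge0 => y; rewrite lee_fin.
Qed.

(** Invariance says that [pi] is the image of the product of [pi] and [mu] under
    the autoregressive map; functions are then handled by Fubini. *)
Lemma invariant_transition (pi : probability 'rV[R]_p R) f n :
  invariant_dist (ar_kernel g mu) pi ->
  measurable_fun setT f -> (forall y, 0 <= f y) ->
  \int[pi]_x f x = \int[pi]_x iter n (transition (ar_map g) mu) f x.
Proof.
move=> hinv mf f0; have mG := measurable_ar_map g_nonexp.
elim: n => [//|n ->] /=.
have mUn := measurable_iter_transition mu mG n mf f0.
have Un0 := iter_transition_ge0 (ar_map g) mu n f0.
move: (iter n _ f) mUn Un0 => {mf f0} f mf f0.
transitivity (\int[law (pi \x mu : probability _ R) mG]_x f x).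
  apply: eq_measure_integral => A mA _; apply: (etrans (hinv A mA)).
  have mA' : measurable_fun setT (fun xz => (\1_A (ar_map g xz))%:E : \bar R).
    apply/measurable_EFinP; apply: (measurableT_comp _ mG).
    exact: measurable_indic.
  have mpre : measurable (ar_map g @^-1` A).
    by rewrite -[X in measurable X]setTI; exact: mG.
  transitivity ((pi \x mu) (ar_map g @^-1` A)); last by [].
  rewrite -(setIT (ar_map g @^-1` A)) -integral_indic//.
  by rewrite (fubini_tonelli1 (m1 := pi) (m2 := mu)).
apply: (etrans (ge0_integral_law _ mG mf f0)).
rewrite (fubini_tonelli1 (m1 := pi) (m2 := mu) (f \o ar_map g))//.
  exact: measurableT_comp.
by move=> xz; exact: f0.
Qed.

(** The converse needs only Lipschitz test functions, since they separate [pi]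
    from that image measure. *)
Lemma transition_invariant (pi : probability 'rV[R]_p R) :
  (forall K h, (0 <= K)%R -> elipschitz K h -> (forall x, 0 <= h x <= 1)%R ->
     \int[pi]_x (h x)%:E = \int[pi]_x transition (ar_map g) mu (EFin \o h) x) ->
  invariant_dist (ar_kernel g mu) pi.
Proof.
move=> hpi A mA; have mG := measurable_ar_map g_nonexp.
have -> : pi A = law (pi \x mu : probability _ R) mG A.
  apply: lipschitz_determining => // K h K0 hK h01.
  have mh : measurable_fun setT (EFin \o h).
    by apply/measurable_EFinP; exact: elipschitz_measurable hK.
  have h0 x : 0 <= (EFin \o h) x by rewrite lee_fin; case/andP: (h01 x).
  rewrite (hpi K h K0 hK h01); apply/esym.
  apply: (etrans (ge0_integral_law _ mG mh h0)).
  rewrite (fubini_tonelli1 (m1 := pi) (m2 := mu) ((EFin \o h) \o ar_map g))//.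
    exact: measurableT_comp.
  by move=> xz; exact: h0.
have mpre : measurable (ar_map g @^-1` A).
  by rewrite -[X in measurable X]setTI; exact: mG.
transitivity ((pi \x mu) (ar_map g @^-1` A)); first by [].
rewrite -(setIT (ar_map g @^-1` A)) -integral_indic//.
have mA' : measurable_fun setT (fun xz => (\1_A (ar_map g xz))%:E : \bar R).
  apply/measurable_EFinP; apply: (measurableT_comp _ mG).
  exact: measurable_indic.
by rewrite (fubini_tonelli1 (m1 := pi) (m2 := mu)).
Qed.

End autoregressive_kernel.

(** * The stationary law *)

Section stationary_law.
Context {R : realType} {p : nat} (mu : probability 'rV[R]_p R).
Variable g : 'rV[R]_p -> 'rV[R]_p.
Hypothesis g_nonexp : forall x y, enorm (g x - g y) <= enorm (x - y).
Context d (Omega : measurableType d) (Pr : probability Omega R).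
Variable Z : nat -> Omega -> 'rV[R]_p.
Hypothesis mZ : forall k, measurable_fun setT (Z k).
Hypothesis indZ : mutually_independent Pr Z.
Hypothesis lawZ : forall n A, measurable A -> Pr (Z n @^-1` A) = mu A.
Variables (W : 'rV[R]_p -> R) (C B : R) (r t : nat -> R).
Hypothesis mW : measurable_fun setT W.
Hypothesis W_ge1 : forall x, 1 <= W x.
Hypothesis C_ge0 : 0 <= C.
Hypothesis B_ge0 : 0 <= B.
Hypothesis W_growth : forall x, (\int[mu]_z (W (g x + z))%:E <= (W x + B)%:E)%E.
Hypothesis r_ge0 : forall n, 0 <= r n.
Hypothesis r_tail : forall n N, \sum_(n <= m < N) r m <= t n.
Hypothesis t_cvg0 : t @ \oo --> 0.
Hypothesis contraction : forall n x y,
  (iter n (transition (sync_map g) mu) (fun xy => (enorm (xy.1 - xy.2))%:E) (x, y)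
   <= (C * (W x + W y) * r n)%:E)%E.

Local Notation Phi := (backward (ar_map g) Z).
Local Notation U := (transition (ar_map g) mu).

Let mG := measurable_ar_map g_nonexp.

Let W_ge0 x : 0 <= W x. Proof. exact: le_trans (W_ge1 x). Qed.

Let mPhi n x : measurable_fun setT (fun w => Phi n w x).
Proof. exact: (measurable_backward mG). Qed.

Let m_enormB (f h : Omega -> 'rV[R]_p) :
  measurable_fun setT f -> measurable_fun setT h ->
  measurable_fun setT (fun w => enorm (f w - h w)).
Proof.
by move=> mf mh; apply: (measurableT_comp measurable_enorm); exact: measurable_rVB.
Qed.

Lemma expected_distance n x y :
  (\int[Pr]_w (enorm (Phi n w x - Phi n w y))%:E <= (C * (W x + W y) * r n)%:E)%E.
Proof.
apply: le_trans (contraction n x y).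
have mD : measurable_fun setT
    (fun xy : 'rV[R]_p * 'rV[R]_p => (enorm (xy.1 - xy.2))%:E).
  by apply/measurable_EFinP; exact: measurable_edist.
have D0 (xy : 'rV[R]_p * 'rV[R]_p) : (0 <= (enorm (xy.1 - xy.2))%:E)%E.
  by rewrite lee_fin enorm_ge0.
rewrite -(integral_backward (measurable_sync_map g_nonexp) mZ indZ lawZ n (x, y) mD D0).
rewrite le_eqVlt; apply/orP; left; apply/eqP; apply: eq_integral => w _.
by rewrite backward_sync.
Qed.

Let measurable_increment d' (O : measurableType d') (Y : nat -> O -> 'rV[R]_p) n :
  (forall k, (k < n)%N -> measurable_fun setT (Y k)) ->
  measurable_fun setT (fun wz : O * 'rV[R]_p =>
    (enorm (backward (ar_map g) Y n wz.1 0
            - backward (ar_map g) Y n wz.1 (ar_map g (0, wz.2))))%:E).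
Proof.
move=> mY; have mB := measurable_backward2 mG n mY.
apply/measurable_EFinP; apply: (measurableT_comp measurable_enorm).
apply: measurable_rVB.
  apply: (measurableT_comp mB (g := fun wz : O * 'rV[R]_p => (wz.1, 0 : 'rV[R]_p))).
  by apply: measurable_fun_pair => //; exact: measurable_fst.
apply: (measurableT_comp mB
  (g := fun wz : O * 'rV[R]_p => (wz.1, ar_map g (0, wz.2)))).
apply: measurable_fun_pair; first exact: measurable_fst.
apply: (measurableT_comp mG (g := fun wz : O * 'rV[R]_p => (0 : 'rV[R]_p, wz.2))).
by apply: measurable_fun_pair => //; exact: measurable_snd.
Qed.

(** The iterates n and n + 1 apply the same n maps, to 0 and to the image of 0
    under a map that is independent of them: the increment is the distance of
    two coupled chains after n steps. *)
Lemma expected_increment n :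
  (\int[Pr]_w (enorm (Phi n w 0 - Phi n.+1 w 0))%:E
   <= (C * (2 * W 0 + B) * r n)%:E)%E.
Proof.
pose h (wz : g_sigma_algebraType (cylinders Z n) * 'rV[R]_p) : \bar R :=
  (enorm (Phi n wz.1 0 - Phi n wz.1 (ar_map g (0, wz.2))))%:E.
have mh : measurable_fun setT h.
  by apply: measurable_increment => k; exact: measurable_past.
have h0 wz : (0 <= h wz)%E by rewrite lee_fin enorm_ge0.
have := integral_past_fresh mZ indZ lawZ mh h0; rewrite /h /= => ->.
have Cr0 : 0 <= C * r n by exact: mulr_ge0.
have mWg : measurable_fun setT (fun z => W (g 0 + z)).
  by apply: (measurableT_comp mW); exact: measurable_rVD.
pose f z := C * r n * W (g 0 + z) + C * r n * W 0.
have mf : measurable_fun setT f.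
  by apply: measurable_funD => //; apply: measurable_funM.
have f0 z : 0 <= f z by rewrite addr_ge0// mulr_ge0.
apply: (@le_trans _ _ (\int[mu]_z (f z)%:E)%E).
  apply: ge0_le_integral => //.
  - by move=> z _; apply: integral_ge0 => w _; rewrite lee_fin enorm_ge0.
  - apply: (@measurable_fun_fubini_tonelli_G _ _ Omega 'rV[R]_p R Pr
      (fun wz => (enorm (Phi n wz.1 0 - Phi n wz.1 (ar_map g (0, wz.2))))%:E)).
    + by apply: measurable_increment.
    + by move=> wz; rewrite lee_fin enorm_ge0.
  - exact/measurable_EFinP.
  - move=> z _; apply: (le_trans (expected_distance n 0 (ar_map g (0, z)))).
    by rewrite lee_fin /f /ar_map/= le_eqVlt; apply/orP; left; apply/eqP; ring.
have := @le_integral_affine _ _ R mu f (fun=> 0) (fun z => W (g 0 + z))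
  (C * r n) (C * r n * W 0) mf (measurable_cst _) mWg f0 (fun=> lexx 0)
  (fun z => W_ge0 _) Cr0 (mulr_ge0 Cr0 (W_ge0 0)).
move=> /(_ _)/le_trans; apply; first by move=> z; rewrite /f add0r.
rewrite integral0 add0e.
apply: (@le_trans _ _ ((C * r n)%:E * (W 0 + B)%:E + (C * r n * W 0)%:E)%E).
  by rewrite leeD2r// lee_wpmul2l// lee_fin.
rewrite -EFinM -EFinD lee_fin le_eqVlt; apply/orP; left; apply/eqP; ring.
Qed.

Let X w := coord_limit (fun n => Phi n w 0).

Let mX : measurable_fun setT X.
Proof. by apply: measurable_coord_limit => n; exact: mPhi. Qed.

(** The law of the pathwise limit of the backward iterates. *)
Definition stationary : probability 'rV[R]_p R := law Pr mX.

Let K0 := C * (1 + 3 * W 0 + B).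

Let r_le_t n : r n <= t n.
Proof. by have := r_tail n n.+1; rewrite big_nat1. Qed.

Lemma expected_distance_limit n x :
  (\int[Pr]_w (enorm (Phi n w x - X w))%:E <= (K0 * W x * t n)%:E)%E.
Proof.
have A0 : 0 <= C * (2 * W 0 + B) by rewrite mulr_ge0// addr_ge0// mulr_ge0.
have h0 : (\int[Pr]_w (enorm (Phi n w 0 - X w))%:E <=
    (C * (2 * W 0 + B) * t n)%:E)%E.
  apply: (@L1_coord_limit _ _ _ _ Pr (fun n w => Phi n w 0)
    (fun n => C * (2 * W 0 + B) * r n) (fun n => C * (2 * W 0 + B) * t n)).
  - by move=> k; exact: mPhi.
  - by move=> k; exact: expected_increment.
  - by move=> k N; rewrite -mulr_sumr ler_wpM2l.
have t0 : 0 <= t n by exact: le_trans (r_ge0 n) (r_le_t n).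
have := @le_integral_affine _ _ R Pr (fun w => enorm (Phi n w x - X w))
  (fun w => enorm (Phi n w x - Phi n w 0)) (fun w => enorm (Phi n w 0 - X w)) 1 0.
move=> /(_ _ _ _ _ _ _ _ _ _)/le_trans; apply => //.
- exact: m_enormB.
- exact: m_enormB.
- exact: m_enormB.
- by move=> w; exact: enorm_ge0.
- by move=> w; exact: enorm_ge0.
- by move=> w; exact: enorm_ge0.
- by move=> w; rewrite mul1r addr0 enorm_triangleB.
rewrite mul1e adde0; apply: (le_trans (leeD (expected_distance n x 0) h0)).
rewrite -EFinD lee_fin /K0.
have h1 : C * (W x + W 0) * r n <= C * (W x + W 0) * t n.
  by rewrite ler_wpM2l// mulr_ge0// addr_ge0.
have h2 : 0 <= C * t n * ((3 * W 0 + B) * (W x - 1)).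
  by rewrite !mulr_ge0 ?subr_ge0// addr_ge0// mulr_ge0.
rewrite (le_trans (lerD h1 (lexx _)))// -subr_ge0 (le_trans h2)//.
by rewrite le_eqVlt; apply/orP; left; apply/eqP; ring.
Qed.

Let kernel_law n x A : measurable A ->
  Pr ((fun w => Phi n w x) @^-1` A) = kernel_iter (ar_kernel g mu) n x A.
Proof.
move=> mA; rewrite kernel_iterE// -(integral_backward mG mZ indZ lawZ).
- have mpre : measurable ((fun w => Phi n w x) @^-1` A).
    by rewrite -[X in measurable X]setTI; exact: mPhi.
  by rewrite -(setIT ((fun w => Phi n w x) @^-1` A)) -integral_indic.
- by apply/measurable_EFinP; exact: measurable_indic.
- by move=> y; rewrite lee_fin.
Qed.

(** The n-th backward iterate and the limit are defined on the same space:
    their joint law is a coupling. *)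
Lemma wasserstein_stationary n x :
  (wasserstein (@d1 R p) (kernel_iter (ar_kernel g mu) n x) stationary
   <= (K0 * W x * t n)%:E)%E.
Proof.
have mPX : measurable_fun setT (fun w => (Phi n w x, X w)).
  exact: measurable_fun_pair.
apply: le_trans (expected_distance_limit n x).
apply: (@le_trans _ _ (\int[law Pr mPX]_xy (d1 xy.1 xy.2)%:E)%E).
  apply: ereal_inf_lbound; exists (law Pr mPX) => // A mA.
  by split; [exact: kernel_law|].
have md1 : measurable_fun setT
    (fun xy : 'rV[R]_p * 'rV[R]_p => (d1 xy.1 xy.2)%:E).
  apply/measurable_EFinP; apply: measurable_minr => //; exact: measurable_edist.
rewrite (ge0_integral_law Pr mPX md1); last first.
  by move=> xy; rewrite lee_fin le_min ler01 enorm_ge0.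
apply: ge0_le_integral => //=.
- by move=> w _; rewrite lee_fin le_min ler01 enorm_ge0.
- exact: (measurableT_comp md1 mPX).
- by apply/measurable_EFinP; exact: m_enormB.
- by move=> w _; rewrite lee_fin d1_le_enorm.
Qed.

(** The n-th iterate of h at x is the expectation of h at the n-th backward
    iterate, which converges in mean to a variable with law [stationary]. *)
Lemma transition_iter_cvg K h x : 0 <= K -> elipschitz K h ->
  (forall x, 0 <= h x <= 1) ->
  iter n U (EFin \o h) x @[n --> \oo] --> (\int[stationary]_y (h y)%:E)%E.
Proof.
move=> K0' hK h01; have mh := elipschitz_measurable hK.
have mh' : measurable_fun setT (EFin \o h) by exact/measurable_EFinP.
have h0 y : 0 <= h y by case/andP: (h01 y).
have h0' y : (0 <= (EFin \o h) y)%E by rewrite lee_fin.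
have SE : (\int[stationary]_y (h y)%:E = \int[Pr]_w (h (X w))%:E)%E.
  exact: (ge0_integral_law Pr mX mh' h0').
have mhX : measurable_fun setT (fun w => h (X w)) by exact: (measurableT_comp mh).
have mhP n : measurable_fun setT (fun w => h (Phi n w x)).
  exact: (measurableT_comp mh).
have UE n : iter n U (EFin \o h) x = (\int[Pr]_w (h (Phi n w x))%:E)%E.
  by rewrite -(integral_backward mG mZ indZ lawZ n x mh' h0').
have Sfin : (\int[stationary]_y (h y)%:E)%E \is a fin_num.
  rewrite ge0_fin_numE; last by apply: integral_ge0 => y _; rewrite lee_fin.
  apply: (@le_lt_trans _ _ (\int[stationary]_y 1%:E)%E).
    apply: ge0_le_integral => //.
    - by move=> y _; rewrite lee_fin.
    - by move=> y _; rewrite lee_fin; case/andP: (h01 y).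
  by rewrite integral_cst// mul1e [X in (X < _)%E]probability_setT ltry.
pose e n := K * (K0 * W x * t n).
have e_cvg : e @ \oo --> 0.
  rewrite -[X in _ --> X](mulr0 K) -(mulr0 (K0 * W x)).
  by apply: cvgMr; apply: cvgMr.
have upper n : (iter n U (EFin \o h) x <= \int[stationary]_y (h y)%:E + (e n)%:E)%E.
  rewrite UE SE.
  have := @le_integral_affine _ _ R Pr (fun w => h (Phi n w x)) (fun w => h (X w))
    (fun w => enorm (Phi n w x - X w)) K 0.
  move=> /(_ _ _ _ _ _ _ _ _ _)/le_trans; apply => //.
  - exact: m_enormB.
  - by move=> w; exact: enorm_ge0.
  - move=> w; rewrite addr0 -lerBlDl.
    by rewrite (le_trans (ler_norm _) (hK _ _)).
  rewrite adde0 leeD2l// /e EFinM lee_wpmul2l ?lee_fin//.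
  exact: expected_distance_limit.
have lower n : (\int[stationary]_y (h y)%:E <= iter n U (EFin \o h) x + (e n)%:E)%E.
  rewrite UE SE.
  have := @le_integral_affine _ _ R Pr (fun w => h (X w)) (fun w => h (Phi n w x))
    (fun w => enorm (Phi n w x - X w)) K 0.
  move=> /(_ _ _ _ _ _ _ _ _ _)/le_trans; apply => //.
  - exact: m_enormB.
  - by move=> w; exact: enorm_ge0.
  - move=> w; rewrite addr0 -lerBlDl enormC.
    by rewrite (le_trans (ler_norm _) (hK _ _)).
  rewrite adde0 leeD2l// /e EFinM lee_wpmul2l ?lee_fin//.
  exact: expected_distance_limit.
set l := fine (\int[stationary]_y (h y)%:E)%E.
have lE : (\int[stationary]_y (h y)%:E)%E = l%:E by rewrite fineK.
rewrite lE; apply: (@squeeze_cvge _ _ _ _ (fun n => (l - e n)%:E) _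
  (fun n => (l + e n)%:E)).
- apply: nearW => n; apply/andP; split.
    by rewrite EFinB leeBlDr// -lE; exact: lower.
  by rewrite EFinD -lE; exact: upper.
- apply: cvg_EFin; first exact: nearW.
  by rewrite -[X in _ --> X]subr0; apply: cvgB => //; exact: cvg_cst.
- apply: cvg_EFin; first exact: nearW.
  by rewrite -[X in _ --> X]addr0; apply: cvgD => //; exact: cvg_cst.
Qed.

(** A Lipschitz h and its image under the transition operator have the same
    iterates up to a shift, so the two limits of [transition_iter_cvg]
    coincide. The image is again Lipschitz because [g] does not expand. *)
Lemma stationary_invariant : invariant_dist (ar_kernel g mu) stationary.
Proof.
apply: transition_invariant => // K h K0' hK h01.
have mh := elipschitz_measurable hK.
have mh' : measurable_fun setT (EFin \o h) by exact/measurable_EFinP.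
have h0 y : (0 <= (EFin \o h) y)%E by rewrite lee_fin; case/andP: (h01 y).
have U01 y : (0 <= U (EFin \o h) y <= 1)%E.
  apply/andP; split; first by apply: transition_ge0.
  apply: (@le_trans _ _ (\int[mu]_z 1%:E)%E).
    apply: ge0_le_integral => //.
    - by apply: (measurableT_comp mh'); apply: (measurableT_comp mG);
        exact: measurable_fun_pair.
    - by move=> z _; rewrite lee_fin; case/andP: (h01 (ar_map g (y, z))).
  by rewrite integral_cst// mul1e [X in (X <= _)%E]probability_setT.
pose k y := fine (U (EFin \o h) y).
have kE : EFin \o k = U (EFin \o h).
  apply/funext => y; rewrite /k /= fineK//; have /andP[u0 u1] := U01 y.
  by rewrite ge0_fin_numE// (le_lt_trans u1)// ltry.
have k01 y : 0 <= k y <= 1.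
  by have := U01 y; rewrite -(congr1 (@^~ y) kE) /= !lee_fin.
have klip : elipschitz K k.
  have half a b : k a <= k b + K * enorm (a - b).
    rewrite -lee_fin EFinD.
    have -> : (k a)%:E = U (EFin \o h) a by exact: (congr1 (@^~ a) kE).
    have -> : (k b)%:E = U (EFin \o h) b by exact: (congr1 (@^~ b) kE).
    have mhz y : measurable_fun setT (fun z => h (ar_map g (y, z))).
      by apply: (measurableT_comp mh); apply: (measurableT_comp mG);
        exact: measurable_fun_pair.
    have hh0 y : 0 <= h y by case/andP: (h01 y).
    have c0 : 0 <= K * enorm (a - b) by rewrite mulr_ge0// enorm_ge0.
    have := @le_integral_affine _ _ R mu (fun z => h (ar_map g (a, z)))
      (fun z => h (ar_map g (b, z))) (fun=> 0) 0 (K * enorm (a - b)).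
    move=> /(_ _ _ _ _ _ _ _ _ _)/le_trans; apply => //.
      move=> z; rewrite mulr0 addr0 -lerBlDl.
      rewrite (le_trans (ler_norm _))// (le_trans (hK _ _))// ler_wpM2l//.
      by rewrite /ar_map/= opprD addrACA subrr addr0.
    by rewrite mul0e adde0.
  move=> a b; rewrite ler_norml; apply/andP; split.
    by rewrite lerBrDr addrC lerBlDr enormC; exact: half.
  by rewrite lerBlDl; exact: half.
have cvg1 := @transition_iter_cvg K k 0 K0' klip k01.
have cvg2 := @transition_iter_cvg K h 0 K0' hK h01.
have -> : (\int[stationary]_y U (EFin \o h) y = \int[stationary]_y (k y)%:E)%E.
  by apply: eq_integral => y _; rewrite -kE.
have E : (fun n => iter n U (EFin \o k) 0) = (fun n => iter n.+1 U (EFin \o h) 0).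
  by apply/funext => n; rewrite iterSr kE.
transitivity (limn (fun n => iter n.+1 U (EFin \o h) 0)).
  by apply/esym/cvg_lim => //; rewrite (cvg_shiftS (fun n => iter n U (EFin \o h) 0)).
by rewrite -E; exact/cvg_lim.
Qed.

(** An invariant law integrates all iterates of h to the same value, and these
    iterates converge boundedly to a constant. *)
Lemma stationary_unique (pi : probability 'rV[R]_p R) :
  invariant_dist (ar_kernel g mu) pi ->
  forall A, measurable A -> pi A = stationary A.
Proof.
move=> hpi; apply: lipschitz_determining => K h K0' hK h01.
have mh := elipschitz_measurable hK.
have mh' : measurable_fun setT (EFin \o h) by exact/measurable_EFinP.
have h0 y : (0 <= (EFin \o h) y)%E by rewrite lee_fin; case/andP: (h01 y).
set l := (\int[stationary]_y (h y)%:E)%E.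
have Un0 n := iter_transition_ge0 (ar_map g) mu n h0.
have mUn n := measurable_iter_transition mu mG n mh' h0.
have Un1 n y : (iter n U (EFin \o h) y <= 1)%E.
  rewrite -(integral_backward mG mZ indZ lawZ n y mh' h0).
  apply: (@le_trans _ _ (\int[Pr]_w 1%:E)%E).
    apply: ge0_le_integral => //.
    - by apply: (measurableT_comp mh'); exact: mPhi.
    - by move=> w _; rewrite lee_fin; case/andP: (h01 (Phi n w y)).
  by rewrite integral_cst// mul1e [X in (X <= _)%E]probability_setT.
have dom : {ae pi, forall x, forall n, [set: 'rV[R]_p] x ->
    (`|iter n U (EFin \o h) x| <= 1)%E}.
  by apply: aeW => x n _; rewrite gee0_abs.
have i1 : pi.-integrable setT (cst 1%E : 'rV[R]_p -> \bar R).
  exact: (finite_measure_integrable_cst pi 1).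
have [_ _ cv] := @dominated_convergence _ _ R pi setT measurableT
  (fun n => iter n U (EFin \o h)) (cst l) (cst 1%E) mUn (measurable_cst _)
  (aeW _ (fun x _ => @transition_iter_cvg K h x K0' hK h01))
  i1 dom.
have E : (fun n => \int[pi]_x iter n U (EFin \o h) x)%E =
    (fun=> \int[pi]_x (h x)%:E)%E.
  by apply/funext => n; rewrite -(invariant_transition g_nonexp n hpi mh' h0).
have lE : (\int[pi]_x l = l)%E.
  by rewrite integral_cst// [X in (_ * X)%E]probability_setT mule1.
transitivity (limn (fun n => \int[pi]_x iter n U (EFin \o h) x)%E).
  by rewrite E; apply/esym/lim_cst.
by rewrite -lE; apply/cvg_lim.
Qed.

End stationary_law.

(** * Tails of stretched exponential series *)

Section stretched_exponential_tails.
Context {R : realType}.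

(** The majorant telescopes when summed. *)
Lemma stretched_exp_decay (a sigma : R) : 0 < a -> 0 < sigma ->
  exists2 Q, 0 < Q & forall m : nat,
    expR (- a * m%:R `^ sigma) <= Q * (m.+1%:R^-1 - m.+2%:R^-1).
Proof.
move=> a0 s0; pose P := (2 / sigma / a) `^ (2 / sigma).
have P0 : 0 <= P by exact: powR_ge0.
exists (2 + 6 * P); first by rewrite ltr_pwDl// mulr_ge0.
move=> m; have m1 : 0 < m.+1%:R :> R by rewrite ltr0n.
have m2 : 0 < m.+2%:R :> R by rewrite ltr0n.
rewrite (_ : _ - _ = (m.+1%:R * m.+2%:R)^-1); last first.
  have -> : m.+2%:R = m.+1%:R + 1 :> R by rewrite -natr1.
  by field; rewrite ?gt_eqF// natr1.
rewrite ler_pdivlMr ?mulr_gt0//.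
set u := m%:R `^ sigma; have u0 : 0 <= u by exact: powR_ge0.
rewrite mulNr expRN ler_pdivrMl ?expR_gt0//.
have e1 : 1 <= expR (a * u).
  by rewrite (le_trans _ (expR_ge1Dx _))// lerDl mulr_ge0// ltW.
have mP : m%:R ^+ 2 <= P * expR (a * u).
  have := powR_le_expR (divr_gt0 (ltr0Sn R 1) s0) a0 u0.
  by rewrite {1}/u -powRrM [sigma * _]mulrC divfK ?gt_eqF// powR_mulrn.
have E1 : m.+1%:R = m%:R + 1 :> R by rewrite natr1.
have E2 : m.+2%:R = m%:R + 1 + 1 :> R by rewrite !natr1.
rewrite E1 E2.
set x : R := m%:R; have x0 : 0 <= x by rewrite ler0n.
have : (x + 1) * (x + 1 + 1) <= 2 + 6 * x ^+ 2.
  rewrite /x; case: (m) => [|k]; first by rewrite expr0n/=; lra.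
  have k1 : 1 <= k.+1%:R :> R by rewrite ler1n.
  have : 0 <= k.+1%:R * (k.+1%:R - 1) :> R by rewrite mulr_ge0 ?subr_ge0.
  by move: k1; set y : R := k.+1%:R; lra.
move=> /le_trans; apply; rewrite -/x in mP; lra.
Qed.

(** Half of the exponent is kept at the first term of the tail, the other half
    makes the series converge. *)
Lemma stretched_exp_tail (c sigma : R) : 0 < c -> 0 < sigma ->
  exists2 D, 0 < D & (forall n N, \sum_(n <= m < N) expR (- c * m%:R `^ sigma)
      <= D * expR (- (c / 2) * n%:R `^ sigma)) /\
    (fun n : nat => D * expR (- (c / 2) * n%:R `^ sigma)) @ \oo --> 0.
Proof.
move=> c0 s0; have c20 : 0 < c / 2 by rewrite divr_gt0.
have [Q Q0 hQ] := stretched_exp_decay c20 s0.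
exists Q => //; split; last first.
  apply: (@squeeze_cvgr _ _ _ _ (fun=> 0) (fun n : nat => Q * Q * n.+1%:R^-1)).
  - apply: nearW => n; rewrite mulr_ge0 ?expR_ge0 ?(ltW Q0)//= -mulrA ler_pM2l//.
    by rewrite (le_trans (hQ n))// ler_pM2l// gerBl invr_ge0.
  - exact: cvg_cst.
  - by rewrite -[X in _ --> X](mulr0 (Q * Q)); apply: cvgMr; exact: cvg_harmonic.
move=> n N; have [Nn|nN] := leqP N n.
  by rewrite big_geq// mulr_ge0 ?expR_ge0// ltW.
have part : \sum_(n <= m < N) (m.+1%:R^-1 - m.+2%:R^-1) <= 1 :> R.
  have -> : \sum_(n <= m < N) (m.+1%:R^-1 - m.+2%:R^-1) =
      n.+1%:R^-1 - N.+1%:R^-1 :> R.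
    rewrite (@telescope_sumr_eq _ n N (fun m : nat => - m.+1%:R^-1 : R)).
    - by rewrite opprK addrC.
    - exact: ltnW.
    - by move=> k _; rewrite opprK addrC.
  rewrite lerBlDr (@le_trans _ _ 1)//; first by rewrite invf_le1// ler1n.
  by rewrite lerDl invr_ge0.
apply: (@le_trans _ _ (\sum_(n <= m < N)
    expR (- (c / 2) * n%:R `^ sigma) * (Q * (m.+1%:R^-1 - m.+2%:R^-1)))).
  rewrite big_nat_cond [leRHS]big_nat_cond; apply: ler_sum => m /andP[/andP[nm _] _].
  have -> : expR (- c * m%:R `^ sigma) =
      expR (- (c / 2) * m%:R `^ sigma) * expR (- (c / 2) * m%:R `^ sigma).
    by rewrite -expRD; congr expR; field.
  apply: ler_pM; rewrite ?expR_ge0//.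
  rewrite ler_expR !mulNr lerN2 ler_pM2l//.
  by apply: ge0_ler_powR; rewrite ?nnegrE ?ler0n ?ler_nat// ltW.
rewrite -mulr_sumr mulrC ler_wpM2r ?expR_ge0// -mulr_sumr.
by rewrite -[leRHS]mulr1 ler_wpM2l// ltW.
Qed.

End stretched_exponential_tails.

(** * Ergodicity *)

Section change_of_variables.
Context d (Omega : measurableType d) {R : realType} (Pr : probability Omega R).
Context d' (T : measurableType d') (mu : probability T R) (Z : Omega -> T).
Local Open Scope ereal_scope.

Lemma integral_same_law (f : T -> \bar R) : measurable_fun setT Z ->
  (forall A, measurable A -> Pr (Z @^-1` A) = mu A) ->
  measurable_fun setT f -> \int[mu]_z f z = \int[Pr]_w f (Z w).
Proof.
move=> mZ lawZ mf; rewrite [LHS]integralE [RHS]integralE.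
have ge0 h : measurable_fun setT h -> (forall x, 0 <= h x) ->
    \int[mu]_z h z = \int[Pr]_w h (Z w).
  move=> mh h0; rewrite -(ge0_integral_law Pr mZ mh h0).
  by apply: eq_measure_integral => A mA _; exact/esym/lawZ.
congr (_ - _).
  have mp : measurable_fun setT f^\+ by exact: measurable_funepos.
  rewrite (ge0 _ mp) => [|x]; last exact: funepos_ge0.
  by apply: eq_integral => w _; rewrite !funeposE.
have mn : measurable_fun setT f^\- by exact: measurable_funeneg.
rewrite (ge0 _ mn) => [|x]; last exact: funeneg_ge0.
by apply: eq_integral => w _; rewrite !funenegE.
Qed.

End change_of_variables.

(** Both regimes at once. The geometric one is the case s = rho. *)
Theorem autoregressive_ergodicity (R : realType) (p : nat)
    (g : 'rV[R]_p -> 'rV[R]_p) (mu : probability 'rV[R]_p R)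
    (d : measure_display) (Omega : measurableType d) (Pr : probability Omega R)
    (Z : nat -> Omega -> 'rV[R]_p) (beta0 kappa0 s rho r M0 : R) :
  (forall k, measurable_fun setT (Z k)) -> mutually_independent Pr Z ->
  (forall n A, measurable A -> Pr (Z n @^-1` A) = mu A) ->
  0 < beta0 -> 0 < kappa0 <= 1 ->
  (\int[mu]_z (expR (beta0 * enorm z `^ kappa0))%:E < +oo)%E ->
  (forall i, \int[mu]_z (z 0 i)%:E = 0)%E ->
  (forall M, 0 < M -> exists C, 0 < C < 1 /\ lipschitz_on_ball g M C) ->
  0 < s -> s <= kappa0 -> s <= rho -> s + rho <= 2 -> rho < 2 -> 0 < r ->
  (forall x, M0 <= enorm x ->
    enorm (g x) <= enorm x * (1 - r * enorm x `^ (- rho))) ->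
  exists pi : probability 'rV[R]_p R,
    [/\ invariant_dist (ar_kernel g mu) pi,
        forall pi' : probability 'rV[R]_p R, invariant_dist (ar_kernel g mu) pi' ->
          forall A, measurable A -> pi' A = pi A &
        exists b C c : R, [/\ 0 < b < beta0, 0 < C, 0 < c &
          forall x n, (wasserstein (@d1 R p) (kernel_iter (ar_kernel g mu) n x) pi
            <= (C * lyap s b x * expR (- c * n%:R `^ (s / rho)))%:E)%E]].
Proof.
move=> mZ indZ lawZ beta00 k01 hexp centered gball s0 sk srho srho2 rho2 r0 gdrift.
have gne := ball_lipschitz_nonexpansive gball.
have [b1 b10 hb1] := kernel_drift gne beta00 k01 hexp centered s0 sk srho srho2
  rho2 r0 gdrift.
pose b := Num.min b1 (beta0 / 2).
have b0 : 0 < b by rewrite lt_min b10 divr_gt0.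
have bb1 : b <= b1 by rewrite ge_min lexx.
have bbeta : b < beta0.
  by rewrite (@le_lt_trans _ _ (beta0 / 2))// ?ge_min ?lexx ?orbT//; lra.
have b30 : 0 < b / 3 by rewrite divr_gt0.
have b3b1 : b / 3 <= b1 by rewrite (le_trans _ bb1)//; lra.
have [c [M [B [c0 _ B0 hgrow hdrift]]]] := hb1 _ b30 b3b1.
have [_ [_ [B' [_ _ B'0 hgrow' _]]]] := hb1 _ b0 bb1.
have [C [c1 [C0 c10 hcontr]]] := sync_contraction gball s0 srho b0 c0 B0 B'0
  hgrow hdrift hgrow'.
have rho0 : 0 < rho by exact: lt_le_trans srho.
have sig0 : 0 < s / rho by rewrite divr_gt0.
have [D D0 [htail hcvg]] := stretched_exp_tail c10 sig0.
have W1 (x : 'rV[R]_p) : 1 <= lyap s b x by apply: lyap_ge1; exact: ltW.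
have mW : measurable_fun setT (lyap s b : 'rV[R]_p -> R).
  exact: measurable_expR_enorm.
have r0' n : 0 <= expR (- c1 * n%:R `^ (s / rho)) by exact: expR_ge0.
exists (stationary gne Pr mZ); split.
- move=> A mA.
  exact: (stationary_invariant gne mZ indZ lawZ mW W1 (ltW C0) (ltW B'0) hgrow'
    r0' htail hcvg hcontr mA).
- move=> pi' hpi' A mA.
  exact: (stationary_unique gne mZ indZ lawZ mW W1 (ltW C0) (ltW B'0) hgrow'
    r0' htail hcvg hcontr hpi' mA).
- exists b, (C * (1 + 3 * lyap s b (0 : 'rV[R]_p) + B') * D), (c1 / 2); split.
  + by rewrite b0.
  + rewrite mulr_gt0// mulr_gt0//.
    by rewrite ltr_pwDr// addr_ge0// mulr_ge0// expR_ge0.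
  + by rewrite divr_gt0.
  + move=> x n.
    have := wasserstein_stationary gne mZ indZ lawZ mW W1 (ltW C0) (ltW B'0) hgrow'
      r0' htail hcontr n x.
    by rewrite mulrA [_ * D * lyap s b x]mulrAC.
Qed.

Unset Implicit Arguments.

Theorem theorem9 (R : realType) (p : nat) (hp : (1 <= p)%N)
    (g : 'rV[R]_p -> 'rV[R]_p) (mu : probability 'rV[R]_p R)
    (d : measure_display) (Omega : measurableType d) (Pr : probability Omega R)
    (X Z : nat -> {RV Pr >-> 'rV[R]_p})
    (hX : ar_process g X Z)
    (beta0 kappa0 rho : R)
    (hAR1 : AR1 mu (X 0%N) Z beta0 kappa0)
    (hAR2 : AR2 g rho) :
  let P := ar_kernel g mu in
  exists pi : probability 'rV[R]_p R,
    [/\ invariant_dist P pi,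
        (forall pi' : probability 'rV[R]_p R, invariant_dist P pi' ->
           forall A, measurable A -> pi' A = pi A),
        (kappa0 < rho ->
           exists beta C1 C2 : R, [/\ 0 < beta < beta0, 0 < C1, 0 < C2 &
             let e := Num.min kappa0 (2 - rho) in
             let V := fun x : 'rV[R]_p => expR (beta * enorm x `^ e) in
             let sigma := e / rho in
             forall (x : 'rV[R]_p) (n : nat), (1 <= n)%N ->
               (wasserstein (@d1 R p) (kernel_iter P n x) pi
                <= (C1 * V x * expR (- C2 * n%:R `^ sigma))%:E)%E]) &
        (rho <= kappa0 ->
           exists beta zeta C : R, [/\ 0 < beta < beta0, 0 < zeta < 1 &
             let V := fun x : 'rV[R]_p => expR (beta * enorm x `^ kappa0) in
             forall (x : 'rV[R]_p) (n : nat), (1 <= n)%N ->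
               (wasserstein (@d1 R p) (kernel_iter P n x) pi
                <= (C * V x * zeta ^+ n)%:E)%E])].
Proof.
move=> P.
have [indZ _ lawZ meanZ [beta00 k01 hexp]] := hAR1.
have [gball [/andP[rho0 rho2] [r [M0 [r0 M00 gdrift]]]]] := hAR2.
have /andP[k0 k1] := k01.
have mZ k : measurable_fun setT (Z k) by [].
have centered i : (\int[mu]_z (z 0 i)%:E = 0)%E.
  have mi : measurable_fun setT (fun z : 'rV[R]_p => (z 0 i)%:E).
    by apply/measurable_EFinP; exact: measurable_coord.
  rewrite (integral_same_law (mZ 0%N) (lawZ 0%N) mi).
  by have := meanZ 0%N i; rewrite unlock.
have [rhok|krho] := leP rho kappa0.
- (* Beyond radius 1 the drift with exponent rho implies that with the larger
     exponent kappa0, for which the rate exponent kappa0 / kappa0 is 1. Also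
     kappa0 <= 2 - kappa0, as kappa0 <= 1. *)
  have gdrift' x : Num.max M0 1 <= enorm x ->
      enorm (g x) <= enorm x * (1 - r * enorm x `^ (- kappa0)).
    rewrite ge_max => /andP[xM x1]; apply: (le_trans (gdrift x xM)).
    rewrite ler_wpM2l ?enorm_ge0// lerD2l lerN2 ler_pM2l//.
    by apply: ler_powR => //; rewrite lerN2.
  have kk : kappa0 + kappa0 <= 2 by lra.
  have k2 : kappa0 < 2 by lra.
  have [pi [inv uniq [b [C [c [bb C0 c0 hW]]]]]] := autoregressive_ergodicity
    mZ indZ lawZ beta00 k01 hexp centered gball k0 (lexx _) (lexx _) kk k2 r0 gdrift'.
  exists pi; split => //.
  move=> _; exists b, (expR (- c)), C; split => //.
    by rewrite expR_gt0 expR_lt1 oppr_lt0.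
  move=> V x n _; have := hW x n.
  by rewrite divff ?gt_eqF// powRr1// -expRM_natr.
- set s := Num.min kappa0 (2 - rho).
  have s0 : 0 < s by rewrite lt_min k0 subr_gt0.
  have sk : s <= kappa0 by rewrite ge_min lexx.
  have srho : s <= rho by rewrite (le_trans sk)// ltW.
  have srho2 : s + rho <= 2 by rewrite -lerBrDr ge_min lexx orbT.
  have [pi [inv uniq [b [C [c [bb C0 c0 hW]]]]]] := autoregressive_ergodicity
    mZ indZ lawZ beta00 k01 hexp centered gball s0 sk srho srho2 rho2 r0 gdrift.
  exists pi; split => //.
  by move=> _; exists b, C, c; split => // e V sigma x n _; exact: hW.
Qed.
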